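(* Let $V_1=Sp(2)/SU(2)$ be equipped with the normal homogeneous metric described in the context, and let $\gamma$ be a unit-speed geodesic of $V_1$ with $\gamma(0)=o$. Then the covariant derivatives at $\gamma(0)$ of the Jacobi operator along $\gamma$ satisfy: (i) $R^{3)}_0=-\|\gamma'\|^2R^{1)}_0=-R^{1)}_0$; (ii) $R^{4)}_0=-\|\gamma'\|^2R^{2)}_0=-R^{2)}_0$.
   Context: The manifold $V_1$. Let $E_{kl}$ be the $4\times4$ matrix units. $sp(2)$ is the real Lie algebra of skew-Hermitian $4\times 4$ matrices $$\begin{pmatrix}a_{11}&a_{12}&a_{13}&a_{14}\\-\overline a_{12}&-a_{11}&\overline a_{14}&-\overline a_{13}\\-\overline a_{13}&-a_{14}&a_{33}&a_{34}\\-\overline a_{14}&a_{13}&-\overline a_{34}&-a_{33}\end{pmatrix}$$ with $a_{11},a_{33}$ purely imaginary and the other $a_{ij}$ complex. Put $S_1=i(E_{11}-E_{22})$, $S_2=i(E_{33}-E_{44})$, $S_3=E_{12}-E_{21}$, $S_4=i(E_{12}+E_{21})$, $S_5=E_{34}-E_{43}$, $S_6=i(E_{34}+E_{43})$, $S_7=E_{13}-E_{31}-E_{24}+E_{42}$, $S_8=i(E_{13}+E_{31}+E_{24}+E_{42})$, $S_9=E_{14}-E_{41}+E_{23}-E_{32}$, $S_{10}=i(E_{14}+E_{41}-E_{23}-E_{32})$, and $Q_1=\frac12S_1-\frac32S_2$, $Q_2=\sqrt{5/2}\,S_3$, $Q_3=\sqrt{5/2}\,S_4$, $Q_4=\frac{\sqrt6}2S_5-\frac{\sqrt2}2S_7$,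 $Q_5=\frac{\sqrt6}2S_6-\frac{\sqrt2}2S_8$, $Q_6=\frac{\sqrt5}2S_9$, $Q_7=\frac{\sqrt5}2S_{10}$, $Q_8=\frac32S_1+\frac12S_2$, $Q_9=S_5+\frac{\sqrt3}2S_7$, $Q_{10}=S_6+\frac{\sqrt3}2S_8$. The inner product $\langle A,B\rangle=-\frac15\mathrm{Tr}(AB)$ on $sp(2)$ is $\mathrm{Ad}(Sp(2))$-invariant and $\{Q_1,\dots,Q_{10}\}$ is orthonormal. $\mathbf h=\mathrm{span}\{Q_8,Q_9,Q_{10}\}\cong su(2)$ is the Lie algebra of the subgroup $H\cong SU(2)$ of $Sp(2)$, and $\mathbf m=\mathrm{span}\{Q_1,\dots,Q_7\}$ is its orthogonal complement, identified with $T_oV_1$, where $o$ is the coset of $H$. $V_1=Sp(2)/H$ carries the $Sp(2)$-invariant Riemannian metric induced by $\langle\cdot,\cdot\rangle|_{\mathbf m}$ (a normal homogeneous space). Jacobi operator. $\nabla$ is the Levi-Civita connection and $R$ its curvature tensor, $R(X,Y)Z=\nabla_X\nabla_YZ-\nabla_Y\nabla_XZ-\nabla_{[X,Y]}Z$. Along $\gamma$, $R_t=R(\cdot,\gamma')\gamma'(t)$ and $R^{i)}_t=(\nabla_{\gamma'}\cdots\nabla_{\gamma'}R)(\cdot,\gamma')\gamma'(t)$ ($i$ covariant derivatives of $R$); $R^{i)}_0$ is the value at $t=0$, an endomorphism of $T_oV_1$. *)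

(* Defs.v *)
From HB Require Import structures.
From mathcomp Require Import all_boot all_order all_algebra.
From mathcomp Require Import complex.
From mathcomp Require Import all_classical all_reals all_analysis.

Set Implicit Arguments.
Unset Strict Implicit.
Unset Printing Implicit Defensive.

Import Order.TTheory GRing.Theory Num.Theory.
Import numFieldNormedType.Exports.

Local Open Scope ring_scope.
Local Open Scope complex_scope.
Local Open Scope classical_set_scope.

(* C^k maps on an open set U, through iterated directional derivatives. *)
Fixpoint Ck (R : realType) (V W : normedModType R) (k : nat) (U : set V)
    (f : V -> W) {struct k} : Prop :=
  if k is k'.+1 then
    (forall x, U x -> differentiable f x) /\ (forall v, Ck k' U ('D_v f))
  else forall x, U x -> {for x, continuous f}.

Definition smooth_on (R : realType) (V W : normedModType R) (U : set V)
    (f : V -> W) : Prop := forall k, Ck k U f.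

(* Riemannian geometry in a coordinate domain of R^n: g x u v is the metric at
   x, and vector fields and curves are given by their coordinates. *)

Definition gram (R : realType) (n : nat)
    (g : 'rV[R]_n.+1 -> 'rV[R]_n.+1 -> 'rV[R]_n.+1 -> R) (x : 'rV[R]_n.+1) :
    'M[R]_n.+1 :=
  \matrix_(i, j) g x (delta_mx 0 i) (delta_mx 0 j).

(* christoffel g x u v is Gamma^k_ij u^i v^j; before raising the index, the row
   below is g(nabla_u v, e_l) for constant fields u, v. *)
Definition christoffel (R : realType) (n : nat)
    (g : 'rV[R]_n.+1 -> 'rV[R]_n.+1 -> 'rV[R]_n.+1 -> R)
    (x u v : 'rV[R]_n.+1) : 'rV[R]_n.+1 :=
  (\row_l (2^-1 * ('D_u (fun y => g y v (delta_mx 0 l) : R^o) x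
                 + 'D_v (fun y => g y u (delta_mx 0 l) : R^o) x
                 - 'D_(delta_mx 0 l) (fun y => g y u v : R^o) x)))
    *m invmx (gram g x).

Definition nabla (R : realType) (n : nat)
    (g : 'rV[R]_n.+1 -> 'rV[R]_n.+1 -> 'rV[R]_n.+1 -> R)
    (X Y : 'rV[R]_n.+1 -> 'rV[R]_n.+1) (x : 'rV[R]_n.+1) : 'rV[R]_n.+1 :=
  'D_(X x) Y x + christoffel g x (X x) (Y x).

Definition lie_bracket (R : realType) (n : nat)
    (X Y : 'rV[R]_n.+1 -> 'rV[R]_n.+1) (x : 'rV[R]_n.+1) : 'rV[R]_n.+1 :=
  'D_(X x) Y x - 'D_(Y x) X x.

Definition curvature_field (R : realType) (n : nat)
    (g : 'rV[R]_n.+1 -> 'rV[R]_n.+1 -> 'rV[R]_n.+1 -> R)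
    (X Y Z : 'rV[R]_n.+1 -> 'rV[R]_n.+1) (x : 'rV[R]_n.+1) : 'rV[R]_n.+1 :=
  nabla g X (nabla g Y Z) x - nabla g Y (nabla g X Z) x
  - nabla g (lie_bracket X Y) Z x.

(* R(u, v)w at x: by tensoriality any extensions of u, v, w may be used. *)
Definition curvature (R : realType) (n : nat)
    (g : 'rV[R]_n.+1 -> 'rV[R]_n.+1 -> 'rV[R]_n.+1 -> R)
    (x u v w : 'rV[R]_n.+1) : 'rV[R]_n.+1 :=
  curvature_field g (cst u) (cst v) (cst w) x.

Definition acceleration (R : realType) (n : nat)
    (g : 'rV[R]_n.+1 -> 'rV[R]_n.+1 -> 'rV[R]_n.+1 -> R)
    (c : R -> 'rV[R]_n.+1) (t : R) : 'rV[R]_n.+1 :=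
  derive1n 2 c t + christoffel g (c t) (derive1 c t) (derive1 c t).

Definition speed (R : realType) (n : nat)
    (g : 'rV[R]_n.+1 -> 'rV[R]_n.+1 -> 'rV[R]_n.+1 -> R)
    (c : R -> 'rV[R]_n.+1) (t : R) : R :=
  Num.sqrt (g (c t) (derive1 c t) (derive1 c t)).

(* nabla_{c'} T for a (1,3)-tensor field T along the curve c. *)
Definition cov_deriv_along (R : realType) (n : nat)
    (g : 'rV[R]_n.+1 -> 'rV[R]_n.+1 -> 'rV[R]_n.+1 -> R)
    (c : R -> 'rV[R]_n.+1)
    (T : R -> 'rV[R]_n.+1 -> 'rV[R]_n.+1 -> 'rV[R]_n.+1 -> 'rV[R]_n.+1)
    (t : R) (u v w : 'rV[R]_n.+1) : 'rV[R]_n.+1 :=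
  let G := christoffel g (c t) (derive1 c t) in
  derive1 (fun s => T s u v w) t + G (T t u v w)
  - T t (G u) v w - T t u (G v) w - T t u v (G w).

(* R^{k)}_t = (nabla_{c'} ... nabla_{c'} R)(., c')c' at t. *)
Definition jacobi_deriv (R : realType) (n : nat)
    (g : 'rV[R]_n.+1 -> 'rV[R]_n.+1 -> 'rV[R]_n.+1 -> R)
    (c : R -> 'rV[R]_n.+1) (k : nat) (t : R) (v : 'rV[R]_n.+1) :
    'rV[R]_n.+1 :=
  iter k (cov_deriv_along g c) (fun s => curvature g (c s))
    t v (derive1 c t) (derive1 c t).

Definition re_mx (R : realType) (m n : nat) (A : 'M[R[i]]_(m, n)) :
  'M[R]_(m, n) := map_mx (@complex.Re R) A.

Definition im_mx (R : realType) (m n : nat) (A : 'M[R[i]]_(m, n)) :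
  'M[R]_(m, n) := map_mx (@complex.Im R) A.

Definition cplx_mx (R : realType) (m n : nat) (A B : 'M[R]_(m, n)) :
  'M[R[i]]_(m, n) := \matrix_(i, j) (A i j +i* B i j).

Definition expm (R : realType) (X : 'M[R[i]]_4) : 'M[R[i]]_4 :=
  let s := fun N : nat => \sum_(k < N) (k`!%:R)^-1 *: X ^+ k in
  cplx_mx (lim (re_mx (s N) @[N --> \oo])) (lim (im_mx (s N) @[N --> \oo])).

(* Emx k l is the matrix unit E_kl, with indices starting at 1. *)
Definition Emx (R : realType) (k l : nat) : 'M[R[i]]_4 :=
  delta_mx (inord k.-1) (inord l.-1).

Definition Smx (R : realType) (k : nat) : 'M[R[i]]_4 :=
  let i := (0 +i* 1) : R[i] in
  match k with
  | 1 => i *: (Emx R 1 1 - Emx R 2 2)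
  | 2 => i *: (Emx R 3 3 - Emx R 4 4)
  | 3 => Emx R 1 2 - Emx R 2 1
  | 4 => i *: (Emx R 1 2 + Emx R 2 1)
  | 5 => Emx R 3 4 - Emx R 4 3
  | 6 => i *: (Emx R 3 4 + Emx R 4 3)
  | 7 => Emx R 1 3 - Emx R 3 1 - Emx R 2 4 + Emx R 4 2
  | 8 => i *: (Emx R 1 3 + Emx R 3 1 + Emx R 2 4 + Emx R 4 2)
  | 9 => Emx R 1 4 - Emx R 4 1 + Emx R 2 3 - Emx R 3 2
  | 10 => i *: (Emx R 1 4 + Emx R 4 1 - Emx R 2 3 - Emx R 3 2)
  | _ => 0
  end.

Definition Qmx (R : realType) (k : nat) : 'M[R[i]]_4 :=
  let r (x : R) : R[i] := x%:C in
  match k with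
  | 1 => r (1 / 2) *: Smx R 1 - r (3 / 2) *: Smx R 2
  | 2 => r (Num.sqrt (5 / 2)) *: Smx R 3
  | 3 => r (Num.sqrt (5 / 2)) *: Smx R 4
  | 4 => r (Num.sqrt 6 / 2) *: Smx R 5 - r (Num.sqrt 2 / 2) *: Smx R 7
  | 5 => r (Num.sqrt 6 / 2) *: Smx R 6 - r (Num.sqrt 2 / 2) *: Smx R 8
  | 6 => r (Num.sqrt 5 / 2) *: Smx R 9
  | 7 => r (Num.sqrt 5 / 2) *: Smx R 10
  | 8 => r (3 / 2) *: Smx R 1 + r (1 / 2) *: Smx R 2
  | 9 => Smx R 5 + r (Num.sqrt 3 / 2) *: Smx R 7
  | 10 => Smx R 6 + r (Num.sqrt 3 / 2) *: Smx R 8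
  | _ => 0
  end.

(* Tr (A B) is real on skew-Hermitian matrices; Re only fixes the type. *)
Definition ip (R : realType) (A B : 'M[R[i]]_4) : R :=
  - (1 / 5) * complex.Re (\tr (A *m B)).

(* The orthogonal projection sp(2) -> m = span {Q_1, ..., Q_7}. *)
Definition proj_m (R : realType) (A : 'M[R[i]]_4) : 'M[R[i]]_4 :=
  \sum_(1 <= k < 8) (ip A (Qmx R k))%:C *: Qmx R k.

(* The given sp(2) consists of the skew-Hermitian X with X^T J + J X = 0. *)
Definition symplJ (R : realType) : 'M[R[i]]_4 :=
  Emx R 1 2 - Emx R 2 1 - Emx R 3 4 + Emx R 4 3.

Definition Sp2 (R : realType) : set 'M[R[i]]_4 :=
  [set A | (map_mx conjc A)^T *m A = 1%:M /\ A^T *m symplJ R *m A = symplJ R].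

Definition lie_h (R : realType) : set 'M[R[i]]_4 :=
  [set X | exists a b c : R, X = a%:C *: Qmx R 8 + b%:C *: Qmx R 9 + c%:C *: Qmx R 10].

(* The connected subgroup with Lie algebra h: it is generated by exp(h). *)
Definition subgroupH (R : realType) : set 'M[R[i]]_4 :=
  [set A | exists2 s : seq 'M[R[i]]_4,
     (forall X, X \in s -> lie_h X) & A = \prod_(X <- s) expm X].

(* Points of V_1 = Sp(2)/H are the left cosets gH with g in Sp(2). *)
Definition cosetH (R : realType) (A : 'M[R[i]]_4) : set 'M[R[i]]_4 :=
  [set A *m B | B in subgroupH (R := R)].

Definition origin (R : realType) : set 'M[R[i]]_4 := cosetH 1%:M.

Definition dmx (R : realType) (sigma : 'rV[R]_7 -> 'M[R[i]]_4)
    (x v : 'rV[R]_7) : 'M[R[i]]_4 :=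
  cplx_mx ('D_v (fun y => re_mx (sigma y)) x)
          ('D_v (fun y => im_mx (sigma y)) x).

(* For a lift sigma of a parametrization x |-> sigma(x)H of V_1, this is the
   image in m = T_o V_1 of the coordinate vector v at x under the differential
   of the left translation by sigma(x)^-1. *)
Definition tangent_m (R : realType) (sigma : 'rV[R]_7 -> 'M[R[i]]_4)
    (x v : 'rV[R]_7) : 'M[R[i]]_4 :=
  proj_m (invmx (sigma x) *m dmx sigma x v).

(* The coordinate expression of the Sp(2)-invariant metric induced by ip on m. *)
Definition metric (R : realType) (sigma : 'rV[R]_7 -> 'M[R[i]]_4)
    (x u v : 'rV[R]_7) : R :=
  ip (tangent_m sigma x u) (tangent_m sigma x v).

(* (U, sigma) is a local coordinate system x |-> sigma(x)H of V_1, presented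
   with a smooth lift sigma to Sp(2); since Sp(2) -> V_1 is a principal bundle,
   every chart of V_1 has such lifts locally. *)
Definition chart (R : realType) (U : set 'rV[R]_7)
    (sigma : 'rV[R]_7 -> 'M[R[i]]_4) : Prop :=
  [/\ open U /\ (forall x, U x -> Sp2 (sigma x)),
      smooth_on U (fun x => re_mx (sigma x)),
      smooth_on U (fun x => im_mx (sigma x)),
      (forall x y, U x -> U y -> cosetH (sigma x) = cosetH (sigma y) -> x = y) &
      (forall x v, U x -> tangent_m sigma x v = 0 -> v = 0)].

Definition coord_expr (R : realType) (U : set 'rV[R]_7)
    (sigma : 'rV[R]_7 -> 'M[R[i]]_4) (gamma : R -> set 'M[R[i]]_4) (t0 : R)
    (c : R -> 'rV[R]_7) : Prop :=
  exists W : set R^o,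
    [/\ open W, W t0, smooth_on W (c : R^o -> 'rV[R]_7) &
        forall t, W t -> U (c t) /\ gamma t = cosetH (sigma (c t))].

Definition smooth_curve (R : realType) (I : set R)
    (gamma : R -> set 'M[R[i]]_4) : Prop :=
  forall t, I t ->
    exists U sigma c, chart U sigma /\ coord_expr U sigma gamma t c.

Definition geodesic (R : realType) (I : set R)
    (gamma : R -> set 'M[R[i]]_4) : Prop :=
  smooth_curve I gamma /\
  forall t U sigma c, I t -> chart U sigma -> coord_expr U sigma gamma t c ->
    acceleration (metric sigma) c t = 0.

Definition unit_speed (R : realType) (I : set R)
    (gamma : R -> set 'M[R[i]]_4) : Prop :=
  forall t U sigma c, I t -> chart U sigma -> coord_expr U sigma gamma t c ->
    speed (metric sigma) c t = 1.

(* Main.v *)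
Require Import Defs.
From HB Require Import structures.
From mathcomp Require Import all_boot all_order all_algebra.
From mathcomp Require Import complex.
From mathcomp Require Import all_classical all_reals all_analysis.
From mathcomp Require Import ring lra.

Set Implicit Arguments.
Unset Strict Implicit.
Unset Printing Implicit Defensive.

Import Order.TTheory GRing.Theory Num.Theory.
Import numFieldNormedType.Exports.

Local Open Scope ring_scope.
Local Open Scope classical_set_scope.

(** Write g = h + m for the reductive splitting of sp(2), [x,y]_m for the
    m-part of a bracket, and R for the curvature tensor.

    Transport everything to m by the coframe theta, the m-part of the
    Maurer-Cartan form alpha = sigma^-1 dsigma of a lift sigma of the chart;
    let omega be the h-part of alpha.  The Maurer-Cartan equation
    d alpha(u,v) = - [alpha u, alpha v] says that
    Lambda(u) = ad(omega u) + 1/2 [theta u, .]_m is torsion free, and it is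
    skew because the inner product is invariant; hence Lambda is the Levi-Civita
    connection in this frame ([christoffel_coframe], [christoffel_chart]).
    Differentiating once more, its curvature is a constant h-invariant tensor on
    m ([conn_curvature], [curvature_chart]).

    Along a geodesic the velocity x = theta(gamma') satisfies
    x' = - [omega(gamma'), x].  For an h-invariant expression in x the terms
    containing omega therefore cancel, and covariant differentiation along gamma
    becomes an algebraic operation: the derivation induced by
    A = 1/2 [x, .]_m ([cov_deriv_jet], [jacobi_deriv_jet]).  Since A x = 0, the
    k-th covariant derivative of the Jacobi operator is ad(A)^k applied to the
    Jacobi operator S of x ([jet_diagonal]).

    The special feature of V_1 is that [.,.]_m is the octonionic vector cross
    product of R^7: its structure constants in the basis Q_1, ..., Q_7 are 0 and
    +-1, and [x,[x,y]_m]_m = <x,y> x - |x|^2 y ([cross_cross]).  So A^2 equals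
    - |x|^2 / 4 on the orthogonal complement of x, where S lives because
    S x = 0 and <S y, x> = 0.  Expanding,
    ad(A)^3 S = A^3 S - 3 A^2 S A + 3 A S A^2 - S A^3
              = - |x|^2 / 4 * (A S - 3 S A + 3 A S - S A) = - |x|^2 ad(A) S,
    which is (i) ([jet3_diagonal]); one more ad(A) gives (ii)
    ([jet4_diagonal]). *)

(** * Calculus of smooth functions on an open set *)

Section Derivatives.
Variables (R : realType) (V : normedModType R).

Lemma is_derive_mxP m n (F : V -> 'M[R]_(m, n)) (x v : V) (dF : 'M[R]_(m, n)) :
  is_derive x v F dF <->
  forall i j, is_derive x v (fun y => F y i j : R^o) (dF i j).
Proof.
split=> [[Fd <-] i j|FE].
  have /derivable_mxP/(_ i j) Fij := Fd.
  by apply: DeriveDef => //; rewrite (derive_mx Fd) mxE.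
have Fd : derivable F x v by apply/derivable_mxP => i j; case: (FE i j).
apply: DeriveDef => //; rewrite (derive_mx Fd); apply/matrixP => i j.
by rewrite mxE; case: (FE i j).
Qed.

Lemma near_eq_differentiable (W : normedModType R) (f g : V -> W) (x : V) :
  (\near x, f x = g x) -> differentiable f x -> differentiable g x.
Proof.
move=> fg df; have fgx := nbhs_singleton fg.
have key : g \o shift x = cst (g x) + 'd f x +o_ 0 id.
  apply/eqaddoP => _ /posnumP[e].
  have /diff_locally/eqaddoP/(_ _ [gt0 of e%:num]) := df.
  have : \forall y \near 0, f (y + x) = g (y + x).
    by move: fg; rewrite (near_shift 0 x) subr0.
  by apply: filterS2 => y; rewrite !fctE/= => <-; rewrite fgx.
apply/diff_locallyP; rewrite (diff_unique (diff_continuous df) key).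
by split => //; exact: diff_continuous.
Qed.

Lemma nearU (U : set V) (x : V) (P : set V) :
  open U -> U x -> (forall y, U y -> P y) -> \near x, P x.
Proof.
move=> Uo Ux UP; apply: filterS (UP) _.
exact: open_nbhs_nbhs.
Qed.

(** The class depends on values in the open set only, so that a formula valid
    there may replace a function whose values outside are arbitrary. *)
Lemma Ck_congr (W : normedModType R) (U : set V) k (f g : V -> W) :
  open U -> (forall x, U x -> f x = g x) -> Ck k U f -> Ck k U g.
Proof.
move=> Uo; elim: k f g => [|k IH] f g fg /=.
  move=> fc x Ux; have fgx : \near x, f x = g x by apply: (nearU Uo Ux) => y /fg.
  rewrite /prop_for /continuous_at -(fg _ Ux).
  apply: cvg_trans (fc _ Ux); exact: near_eq_cvg.
move=> [fd fD]; split=> [x Ux|v].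
  by apply: near_eq_differentiable (fd _ Ux); apply: (nearU Uo Ux) => y /fg.
apply: IH (fD v) => x Ux.
by apply: near_eq_derive; apply: (nearU Uo Ux) => y /fg.
Qed.

Lemma smooth_congr (W : normedModType R) (U : set V) (f g : V -> W) :
  open U -> (forall x, U x -> f x = g x) -> smooth_on U f -> smooth_on U g.
Proof. by move=> Uo fg fs k; apply: Ck_congr (fs k). Qed.

Lemma CkW (W : normedModType R) (U : set V) k (f : V -> W) :
  Ck k.+1 U f -> Ck k U f.
Proof.
elim: k f => [|k IH] f [fd fD].
  by move=> x Ux; apply/differentiable_continuous/fd.
by split=> // v; apply: IH.
Qed.

Lemma smooth_derive (W : normedModType R) (U : set V) (f : V -> W) v :
  smooth_on U f -> smooth_on U ('D_v f).
Proof. by move=> fs k; have [_ fD] := fs k.+1; exact: fD. Qed.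

Lemma smooth_diff (W : normedModType R) (U : set V) (f : V -> W) x :
  smooth_on U f -> U x -> differentiable f x.
Proof. by move=> fs Ux; have [fd _] := fs 1%N; exact: fd. Qed.

Lemma smooth_is_derive (W : normedModType R) (U : set V) (f : V -> W) x v :
  smooth_on U f -> U x -> is_derive x v f ('D_v f x).
Proof. by move=> fs Ux; apply/derivableP/diff_derivable/smooth_diff/Ux. Qed.

Lemma Ck_cst (W : normedModType R) (U : set V) k (a : W) : Ck k U (cst a).
Proof.
elim: k a => [|k IH] a; first by move=> x _; exact: cst_continuous.
split=> [x _|v]; first exact: differentiable_cst.
have -> : 'D_v (cst a) = cst 0 :> (V -> W) by apply/funext => x; exact: derive_cst.
exact: IH.
Qed.

Lemma smooth_cst (W : normedModType R) (U : set V) (a : W) :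
  smooth_on U (fun _ : V => a).
Proof. by move=> k; exact: Ck_cst. Qed.

Variable U : set V.
Hypothesis Uo : open U.

Lemma CkD (W : normedModType R) k (f g : V -> W) :
  Ck k U f -> Ck k U g -> Ck k U (fun x => f x + g x).
Proof.
elim: k f g => [|k IH] f g.
  by move=> fc gc x Ux; apply: cvgD; [exact: fc|exact: gc].
move=> [fd fD] [gd gD]; split=> [x Ux|v].
  by apply: differentiableD; [exact: fd|exact: gd].
apply: Ck_congr (IH _ _ (fD v) (gD v)) => // x Ux.
by rewrite deriveD //; apply: diff_derivable; [exact: fd|exact: gd].
Qed.

Lemma smoothD (W : normedModType R) (f g : V -> W) :
  smooth_on U f -> smooth_on U g -> smooth_on U (fun x => f x + g x).
Proof. by move=> fs gs k; exact: CkD. Qed.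

Lemma CkM k (f g : V -> R^o) :
  Ck k U f -> Ck k U g -> Ck k U (fun x => f x * g x : R^o).
Proof.
elim: k f g => [|k IH] f g.
  by move=> fc gc x Ux; exact: (continuousM (fc _ Ux) (gc _ Ux)).
move=> fk gk; have [fd fD] := fk; have [gd gD] := gk.
have fd' x v : U x -> derivable f x v by move=> Ux; exact/diff_derivable/fd.
have gd' x v : U x -> derivable g x v by move=> Ux; exact/diff_derivable/gd.
split=> [x Ux|v].
  by apply: differentiableM; [exact: fd|exact: gd].
apply: (@Ck_congr _ _ _ (fun x => (f x * 'D_v g x : R^o) + (g x * 'D_v f x : R^o)))
  => // [x Ux|].
  by rewrite deriveM //; [exact: fd'|exact: gd'].
by apply: CkD; apply: IH; [exact: CkW|exact: gD|exact: CkW|exact: fD].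
Qed.

Lemma smoothM (f g : V -> R^o) :
  smooth_on U f -> smooth_on U g -> smooth_on U (fun x => f x * g x : R^o).
Proof. by move=> fs gs k; exact: CkM. Qed.

Lemma smoothN (f : V -> R^o) : smooth_on U f -> smooth_on U (fun x => - f x : R^o).
Proof.
move=> fs; apply: (@smooth_congr _ _ (fun x => (- 1 : R^o) * f x : R^o)) => //.
  by move=> x _; rewrite mulN1r.
by apply: smoothM => //; exact: smooth_cst.
Qed.

Lemma smooth_sum (I : Type) (r : seq I) (P : pred I) (f : I -> V -> R^o) :
  (forall i, smooth_on U (f i)) ->
  smooth_on U (fun x => \sum_(i <- r | P i) f i x : R^o).
Proof.
move=> fs; elim: r => [|i r IH].
  by apply: (smooth_congr Uo _ (smooth_cst _ (0 : R^o))) => x _; rewrite big_nil.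
apply: (@smooth_congr _ _
  (fun x => (if P i then f i x else 0 : R^o) + \sum_(j <- r | P j) f j x : R^o)) => //.
  by move=> x _; rewrite big_cons; case: ifP => // _; rewrite add0r.
by apply: smoothD => //; case: (P i) => //; exact: smooth_cst.
Qed.

Lemma smooth_prod (I : Type) (r : seq I) (P : pred I) (f : I -> V -> R^o) :
  (forall i, smooth_on U (f i)) ->
  smooth_on U (fun x => \prod_(i <- r | P i) f i x : R^o).
Proof.
move=> fs; elim: r => [|i r IH].
  by apply: (smooth_congr Uo _ (smooth_cst _ (1 : R^o))) => x _; rewrite big_nil.
apply: (@smooth_congr _ _
  (fun x => (if P i then f i x else 1 : R^o) * \prod_(j <- r | P j) f j x : R^o)) => //.
  by move=> x _; rewrite big_cons; case: ifP => // _; rewrite mul1r.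
by apply: smoothM => //; case: (P i) => //; exact: smooth_cst.
Qed.

Lemma smoothV (f : V -> R^o) : (forall x, U x -> f x != 0) ->
  smooth_on U f -> smooth_on U (fun x => (f x)^-1 : R^o).
Proof.
move=> f0 fs; elim=> [|k IH].
  move=> x Ux; apply: differentiable_continuous.
  by apply: differentiableV; [exact: smooth_diff Ux|exact: f0].
split=> [x Ux|v].
  by apply: differentiableV; [exact: smooth_diff Ux|exact: f0].
apply: (@Ck_congr _ _ _ (fun x => ((- 'D_v f x : R^o) * (f x)^-1 : R^o) * (f x)^-1 : R^o))
  => // [x Ux|].
  rewrite deriveV ?f0 //; last exact: (diff_derivable (smooth_diff fs Ux)).
  by rewrite /GRing.scale/= -exprVn expr2; ring.
apply: CkM => //; apply: CkM => //.
exact: (smoothN (smooth_derive v fs)).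
Qed.

End Derivatives.

Lemma smooth_entry (R : realType) (V : normedModType R) (U : set V) m n
    (f : V -> 'M[R]_(m, n)) i j :
  open U -> smooth_on U f -> smooth_on U (fun x => f x i j : R^o).
Proof.
move=> Uo fs k; elim: k f fs => [|k IH] f fs.
  move=> x Ux; apply: differentiable_continuous.
  exact: (differentiable_comp (smooth_diff fs Ux) (differentiable_coord _ i j)).
split=> [x Ux|v].
  exact: (differentiable_comp (smooth_diff fs Ux) (differentiable_coord _ i j)).
apply: Ck_congr (IH _ (smooth_derive v fs)) => // x Ux.
by rewrite derive_mx ?mxE//; exact: (diff_derivable (smooth_diff fs Ux)).
Qed.

(** * Symmetry of second derivatives *)

Section Schwarz.
Variables (R : realType) (V : normedModType R).

Lemma is_derive_line (g : V -> R^o) (p w : V) (s : R) :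
  differentiable g (s *: w + p) ->
  is_derive s 1 (fun s : R => g (s *: w + p) : R^o) ('D_w g (s *: w + p)).
Proof.
move=> gdiff; have gd : derivable g (s *: w + p) w by exact: diff_derivable.
have E : (fun h : R => h^-1 *: (g ((h *: 1 + s) *: w + p) - g (s *: w + p))) =
         (fun h : R => h^-1 *: (g (h *: w + (s *: w + p)) - g (s *: w + p))).
  by apply/funext => h; rewrite scalerDl addrA /GRing.scale/= mulr1.
apply: DeriveDef; first by rewrite /derivable/= E; exact: gd.
by rewrite /derive/= E.
Qed.

Lemma mean_value_0h (phi d : R -> R^o) (h : R) : 0 < h ->
  (forall s : R, 0 <= s <= h -> is_derive s 1 phi (d s)) ->
  exists2 s : R, 0 <= s <= h & phi h - phi 0 = d s * h.
Proof.
move=> h0 dphi.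
have [|c|s sI E] := @MVT_segment R phi d 0 h (ltW h0).
- move=> s; rewrite in_itv /= => /andP[s0 sh]; apply: dphi.
  by rewrite !ltW.
- apply: derivable_within_continuous => s; rewrite in_itv /= => /dphi.
  by case.
exists s; first by move: sI; rewrite in_itv.
by rewrite E subr0.
Qed.

(** The mean value theorem is applied first to s |-> f(s u + h v + x) - f(s u + x),
    then to t |-> D_u f (t v + s u + x). *)
Lemma second_difference_mean_value (U : set V) (f : V -> R^o) (x u v : V) (h : R) :
  smooth_on U f -> 0 < h ->
  (forall s t : R, 0 <= s <= h -> 0 <= t <= h -> U (s *: u + (t *: v + x))) ->
  exists s t : R, [/\ 0 <= s <= h, 0 <= t <= h &
    f (h *: u + (h *: v + x)) - f (h *: u + x) - (f (h *: v + x) - f x)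
    = 'D_v ('D_u f) (s *: u + (t *: v + x)) * h * h].
Proof.
move=> fs h0 hU.
have h00 : 0 <= (0 : R) <= h by rewrite lexx ltW.
have hhh : 0 <= h <= h by rewrite lexx ltW.
have hU0 (s : R) : 0 <= s <= h -> U (s *: u + x).
  by move=> sh; have := hU _ _ sh h00; rewrite scale0r add0r.
pose phi s : R^o := f (s *: u + (h *: v + x)) - f (s *: u + x).
have dphi s : 0 <= s <= h -> is_derive s 1 phi
    ('D_u f (s *: u + (h *: v + x)) - 'D_u f (s *: u + x)).
  move=> sh; apply: is_deriveB.
    exact: (is_derive_line (smooth_diff fs (hU _ _ sh hhh))).
  exact: (is_derive_line (smooth_diff fs (hU0 _ sh))).
have [s sh Es] := mean_value_0h h0 dphi.
pose psi t : R^o := 'D_u f (t *: v + (s *: u + x)).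
have dpsi t : 0 <= t <= h ->
    is_derive t 1 psi ('D_v ('D_u f) (t *: v + (s *: u + x))).
  move=> th; apply: is_derive_line; apply: (smooth_diff (smooth_derive u fs)).
  by rewrite addrCA; exact: hU.
have [t th Et] := mean_value_0h h0 dpsi.
exists s, t; split=> //.
move: Es Et; rewrite /phi /psi !scale0r !add0r => ->.
rewrite [s *: u + (h *: v + x)]addrCA => ->.
by rewrite [s *: u + (t *: v + x)]addrCA.
Qed.

(** Schwarz: the second difference of f at x with steps h u and h v equals
    h^2 times a mixed derivative at a nearby point, in either order of
    differentiation; let h tend to 0 and use continuity. *)
Lemma smooth_derive_comm (U : set V) (f : V -> R^o) (x u v : V) :
  open U -> smooth_on U f -> U x -> 'D_u ('D_v f) x = 'D_v ('D_u f) x.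
Proof.
move=> Uo fs Ux; apply/eqP; rewrite -subr_eq0 -normr_le0; apply/ler_addgt0Pl => e e0.
rewrite addr0.
have e20 : 0 < e / 2 by rewrite divr_gt0.
have cont w1 w2 : \forall y \near x,
    `|'D_w1 ('D_w2 f) x - 'D_w1 ('D_w2 f) y| < e / 2.
  have := differentiable_continuous
    (smooth_diff (smooth_derive w1 (smooth_derive w2 fs)) Ux).
  by move/cvgrPdist_lt => /(_ _ e20).
have : \forall y \near x, [/\ U y,
    `|'D_u ('D_v f) x - 'D_u ('D_v f) y| < e / 2 &
    `|'D_v ('D_u f) x - 'D_v ('D_u f) y| < e / 2].
  have xU : \forall y \near x, U y by exact: open_nbhs_nbhs.
  by apply: filterS3 xU (cont u v) (cont v u) => y.
move/nbhs_ballP => [r r0 rP].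
(* The parallelogram with sides h u and h v must fit into the ball of radius r. *)
pose M := `|u| + `|v| + 1.
have M0 : 0 < M by rewrite ltr_wpDl ?addr_ge0.
pose h := r / 2 / M.
have h0 : 0 < h by rewrite !divr_gt0.
have inr (s t : R) : 0 <= s <= h -> 0 <= t <= h -> ball x r (s *: u + (t *: v + x)).
  move=> /andP[s0 sh] /andP[t0 th]; rewrite -ball_normE /ball_/=.
  rewrite addrA opprD addrCA subrr addr0 normrN.
  apply: le_lt_trans (ler_normD _ _) _; rewrite !normrZ !ger0_norm //.
  apply: (@le_lt_trans _ _ (h * M)).
    rewrite /M !mulrDr mulr1 -[leLHS]addr0; apply: lerD; last exact: ltW.
    by apply: lerD; apply: ler_wpM2r.
  by rewrite /h divfK ?gt_eqF// ltr_pdivrMr// ltr_pMr// ltr1n.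
have [s [t [sh th E1]]] := @second_difference_mean_value U f x u v h fs h0
  (fun s t sh th => let: And3 a _ _ := rP _ (inr s t sh th) in a).
have inr' (s' t' : R) : 0 <= s' <= h -> 0 <= t' <= h -> ball x r (s' *: v + (t' *: u + x)).
  by move=> *; rewrite addrCA; exact: inr.
have [s' [t' [sh' th' E2]]] := @second_difference_mean_value U f x v u h fs h0
  (fun s t sh th => let: And3 a _ _ := rP _ (inr' s t sh th) in a).
have [_ _ d1] := rP _ (inr s t sh th).
have [_ d2 _] := rP _ (inr' s' t' sh' th').
have E : 'D_v ('D_u f) (s *: u + (t *: v + x)) =
         'D_u ('D_v f) (s' *: v + (t' *: u + x)).
  have sym (p q m w : R) : p - q - (m - w) = p - m - (q - w) by ring.
  apply: (mulIf (lt0r_neq0 h0)); apply: (mulIf (lt0r_neq0 h0)).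
  move: E1 E2; rewrite [h *: v + (h *: u + x)]addrCA sym => -> E2.
  exact: E2.
rewrite -E in d2.
apply: le_trans (ler_distD ('D_v ('D_u f) (s *: u + (t *: v + x))) _ _) _.
rewrite [e]splitr; apply: lerD; apply: ltW; first exact: d2.
rewrite distrC; exact: d1.
Qed.

End Schwarz.

(** * Derivatives of matrix-valued functions *)

Section LinearDerivatives.
Variables (R : realType) (V : normedModType R).

(** Reduces a linear map to finitely many constant coefficients, so that its
    derivative needs no continuity argument. *)
Lemma linear_mx_sum m n (W : lmodType R) (f : 'M[R]_(m, n) -> W) (A : 'M[R]_(m, n)) :
  linear f -> f A = \sum_i \sum_j A i j *: f (delta_mx i j).
Proof.
move=> fl; pose L : {linear 'M[R]_(m, n) -> W} :=
  HB.pack f (GRing.isLinear.Build _ _ _ _ f fl).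
rewrite -[f]/(L : _ -> _) {1}[A]matrix_sum_delta linear_sum.
by apply: eq_bigr => i _; rewrite linear_sum; apply: eq_bigr => j _; rewrite linearZ.
Qed.

Lemma is_derive_scaler m n (f : V -> R^o) (x v : V) (df : R^o) (a : 'M[R]_(m, n)) :
  is_derive x v f df -> is_derive x v (fun y => f y *: a) (df *: a).
Proof.
move=> fd; apply/is_derive_mxP => i j; rewrite mxE.
apply: (@near_eq_is_derive _ _ _ (fun y => a i j *: f y)).
  by near=> y; rewrite mxE /GRing.scale/= mulrC.
by rewrite mulrC; exact: is_deriveZ.
Unshelve. all: by end_near. Qed.

Lemma is_derive_linear m n p q (f : 'M[R]_(m, n) -> 'M[R]_(p, q))
    (A : V -> 'M[R]_(m, n)) (x v : V) dA :
  linear f -> is_derive x v A dA -> is_derive x v (fun y => f (A y)) (f dA).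
Proof.
move=> fl /is_derive_mxP Ad; rewrite (linear_mx_sum dA fl).
have -> : (fun y => f (A y)) =
    \sum_i \sum_j (fun y => A y i j *: f (delta_mx i j)).
  apply/funext => y; rewrite fct_sumE (linear_mx_sum (A y) fl).
  by apply: eq_bigr => i _; rewrite fct_sumE.
by apply: is_derive_sum => i; apply: is_derive_sum => j; exact: is_derive_scaler.
Qed.

Lemma is_derive_bilinear m n m' n' p q
    (B : 'M[R]_(m, n) -> 'M[R]_(m', n') -> 'M[R]_(p, q))
    (F : V -> 'M[R]_(m, n)) (G : V -> 'M[R]_(m', n')) (x v : V) dF dG :
  (forall b, linear (B ^~ b)) -> (forall a, linear (B a)) ->
  is_derive x v F dF -> is_derive x v G dG ->
  is_derive x v (fun y => B (F y) (G y)) (B dF (G x) + B (F x) dG).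
Proof.
move=> Bl Br Fd Gd; have /is_derive_mxP Fd' := Fd.
have -> : (fun y => B (F y) (G y)) =
    \sum_i \sum_j (fun y => F y i j *: B (delta_mx i j) (G y)).
  apply/funext => y; rewrite fct_sumE (linear_mx_sum (F y) (Bl (G y))).
  by apply: eq_bigr => i _; rewrite fct_sumE.
have -> : B dF (G x) + B (F x) dG =
    \sum_i \sum_j (dF i j *: B (delta_mx i j) (G x) + F x i j *: B (delta_mx i j) dG).
  rewrite (linear_mx_sum dF (Bl _)) (linear_mx_sum (F x) (Bl _)) -big_split.
  by apply: eq_bigr => i _; rewrite -big_split.
apply: is_derive_sum => i; apply: is_derive_sum => j.
have /is_derive_mxP Bd := is_derive_linear (Br (delta_mx i j)) Gd.
apply/is_derive_mxP => k l.
rewrite !mxE; under eq_fun do rewrite mxE.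
rewrite addrC [dF i j * _]mulrC.
exact: (is_deriveM (Fd' i j) (Bd k l)).
Qed.

Lemma is_derive_mulmx m n p (F : V -> 'M[R]_(m, n)) (G : V -> 'M[R]_(n, p)) (x v : V) dF dG :
  is_derive x v F dF -> is_derive x v G dG ->
  is_derive x v (fun y => F y *m G y) (dF *m G x + F x *m dG).
Proof.
apply: is_derive_bilinear => [b|a] c A B.
  by rewrite mulmxDl scalemxAl.
by rewrite mulmxDr scalemxAr.
Qed.

Lemma is_derive_comp_curve (W : normedModType R) (f : V -> W) (c : R -> V)
    (t : R) (dc : V) :
  differentiable f (c t) -> is_derive (t : R^o) 1 (c : R^o -> V) dc ->
  is_derive (t : R^o) 1 ((fun s => f (c s)) : R^o -> W) ('D_dc f (c t)).
Proof.
move=> fd [cd <-].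
have cd' : differentiable (c : R^o -> V) t by apply/derivable1_diffP.
have fcd := differentiable_comp cd' fd.
apply: DeriveDef; first exact: diff_derivable.
rewrite [LHS](deriveE _ fcd) [LHS](_ : _ = ('d f (c t) \o 'd (c : R^o -> V) t) 1).
  by rewrite /= (deriveE _ fd) (deriveE _ cd').
by rewrite -(diff_comp cd' fd).
Qed.

End LinearDerivatives.

Section SmoothMatrices.
Variables (R : realType) (V : normedModType R) (U : set V).
Hypothesis Uo : open U.

Definition smooth_mx m n (F : V -> 'M[R]_(m, n)) :=
  forall i j, smooth_on U (fun x => F x i j : R^o).

Lemma smooth_mx_is_derive m n (F : V -> 'M[R]_(m, n)) x v :
  smooth_mx F -> U x -> is_derive x v F ('D_v F x).
Proof.
move=> Fs Ux; apply/derivableP/derivable_mxP => i j.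
exact/diff_derivable/(smooth_diff (Fs i j)).
Qed.

Lemma derive_entry m n (F : V -> 'M[R]_(m, n)) x v i j :
  smooth_mx F -> U x -> 'D_v F x i j = 'D_v (fun y => F y i j : R^o) x.
Proof.
move=> Fs Ux; have [Fd _] := smooth_mx_is_derive v Fs Ux.
by rewrite (derive_mx Fd) mxE.
Qed.

Lemma smooth_mx_congr m n (F G : V -> 'M[R]_(m, n)) :
  (forall x, U x -> F x = G x) -> smooth_mx F -> smooth_mx G.
Proof.
by move=> FG Fs i j; apply: smooth_congr (Fs i j) => // x Ux; rewrite FG.
Qed.

Lemma smooth_mx_derive m n (F : V -> 'M[R]_(m, n)) v :
  smooth_mx F -> smooth_mx ('D_v F).
Proof.
move=> Fs i j; apply: smooth_congr (smooth_derive v (Fs i j)) => // x Ux.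
by rewrite derive_entry.
Qed.

Lemma smooth_mx_derive_comm m n (F : V -> 'M[R]_(m, n)) x u v :
  smooth_mx F -> U x -> 'D_u ('D_v F) x = 'D_v ('D_u F) x.
Proof.
move=> Fs Ux; apply/matrixP => i j.
have E w w' : 'D_w ('D_w' F) x i j = 'D_w ('D_w' (fun y => F y i j : R^o)) x.
  rewrite (derive_entry _ _ _ (smooth_mx_derive _ Fs)) //.
  apply: near_eq_derive; apply: (nearU Uo Ux) => y Uy.
  by rewrite derive_entry.
exact: (etrans (E u v) (etrans (smooth_derive_comm u v Uo (Fs i j) Ux) (esym (E v u)))).
Qed.

Lemma smooth_mx_differentiable m n (F : V -> 'M[R]_(m, n)) x :
  smooth_mx F -> U x -> differentiable F x.
Proof.
move=> Fs Ux.
pose G i j : V -> 'M[R]_(m, n) := fun y => F y i j *: delta_mx i j.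
have GE : F = \sum_i \sum_j G i j.
  apply/funext => y; rewrite fct_sumE {1}[F y]matrix_sum_delta.
  by apply: eq_bigr => i _; rewrite fct_sumE.
rewrite GE; apply: differentiable_sum => i; apply: differentiable_sum => j.
exact: (differentiableZl (delta_mx i j) (smooth_diff (Fs i j) Ux)).
Qed.

Lemma smooth_mx_cst m n (A : 'M[R]_(m, n)) : smooth_mx (fun=> A).
Proof. by move=> i j; exact: smooth_cst. Qed.

Lemma smooth_mxD m n (F G : V -> 'M[R]_(m, n)) :
  smooth_mx F -> smooth_mx G -> smooth_mx (fun x => F x + G x).
Proof.
move=> Fs Gs i j; apply: smooth_congr (smoothD Uo (Fs i j) (Gs i j)) => // x _.
by rewrite mxE.
Qed.

Lemma smooth_mxN m n (F : V -> 'M[R]_(m, n)) :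
  smooth_mx F -> smooth_mx (fun x => - F x).
Proof.
move=> Fs i j; apply: smooth_congr (smoothN Uo (Fs i j)) => // x _.
by rewrite mxE.
Qed.

Lemma smooth_mxT m n (F : V -> 'M[R]_(m, n)) :
  smooth_mx F -> smooth_mx (fun x => (F x)^T).
Proof.
by move=> Fs i j; apply: smooth_congr (Fs j i) => // x _; rewrite mxE.
Qed.

Lemma smooth_mxM m n p (F : V -> 'M[R]_(m, n)) (G : V -> 'M[R]_(n, p)) :
  smooth_mx F -> smooth_mx G -> smooth_mx (fun x => F x *m G x).
Proof.
move=> Fs Gs i j.
apply: (@smooth_congr _ _ _ _ (fun x => \sum_k (F x i k * G x k j) : R^o)) => //.
  by move=> x _; rewrite mxE.
by apply: smooth_sum => // k; apply: smoothM.
Qed.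

Lemma smooth_det n (F : V -> 'M[R]_n) :
  smooth_mx F -> smooth_on U (fun x => \det (F x) : R^o).
Proof.
move=> Fs; rewrite /determinant; apply: smooth_sum => // s.
by apply: smoothM => //; [exact: smooth_cst|apply: smooth_prod].
Qed.

(** Cramer's rule. *)
Lemma smooth_invmx n (F : V -> 'M[R]_n) :
  smooth_mx F -> (forall x, U x -> F x \in unitmx) ->
  smooth_mx (fun x => invmx (F x)).
Proof.
move=> Fs Fu i j.
apply: (@smooth_congr _ _ _ _ (fun x => (\det (F x))^-1 * cofactor (F x) j i : R^o)) => //.
  by move=> x Ux; rewrite /invmx Fu // !mxE.
apply: smoothM => //.
  apply: smoothV => //; last exact: smooth_det.
  by move=> x /Fu; rewrite unitmxE unitfE.
apply: smoothM => //; first exact: smooth_cst.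
apply: smooth_det => k l.
by apply: smooth_congr (Fs (lift j k) (lift i l)) => // x _; rewrite !mxE.
Qed.

End SmoothMatrices.

Section LinearDerivativeCorollaries.
Variables (R : realType) (V : normedModType R).

Lemma is_derive_mulmxl m n p (A : 'M[R]_(m, n)) (G : V -> 'M[R]_(n, p)) (x v : V) dG :
  is_derive x v G dG -> is_derive x v (fun y => A *m G y) (A *m dG).
Proof.
move=> Gd; have -> : A *m dG = 0 *m G x + A *m dG by rewrite mul0mx add0r.
exact: (is_derive_mulmx (is_derive_cst A x v) Gd).
Qed.

Lemma is_derive_trmx m n (F : V -> 'M[R]_(m, n)) (x v : V) dF :
  is_derive x v F dF -> is_derive x v (fun y => (F y)^T) dF^T.
Proof. by apply: is_derive_linear => a A B; rewrite linearP. Qed.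

End LinearDerivativeCorollaries.

(** * Levi-Civita connection and curvature in an orthonormal coframe *)

Definition dot (R : realType) n (a b : 'rV[R]_n) : R := (a *m b^T) 0 0.

Section Dot.
Variables (R : realType) (n : nat).
Implicit Types (a b d : 'rV[R]_n).

Lemma dotDl a b d : dot (a + b) d = dot a d + dot b d.
Proof. by rewrite /dot mulmxDl mxE. Qed.

Lemma dotC a b : dot a b = dot b a.
Proof. by rewrite /dot -[a *m _]trmxK trmx_mul trmxK [LHS]mxE. Qed.

Lemma dotDr a b d : dot d (a + b) = dot d a + dot d b.
Proof. by rewrite dotC dotDl !(dotC d). Qed.

Lemma dot_skew (L : 'M[R]_n) a b : L^T = - L -> dot (a *m L) b = - dot a (b *m L).
Proof. by move=> Ls; rewrite /dot trmx_mul Ls mulNmx mulmxN [X in - X]mxE opprK mulmxA. Qed.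

Lemma dot_skew0 (L : 'M[R]_n) a : L^T = - L -> dot (a *m L) a = 0.
Proof.
move=> Ls; have := dot_skew a a Ls; rewrite (dotC a) => /eqP.
by rewrite -addr_eq0 -mulr2n mulrn_eq0 /= => /eqP.
Qed.

Lemma dot_delta a (T : 'M[R]_n) l : dot a (delta_mx 0 l *m T) = (a *m T^T) 0 l.
Proof. by rewrite /dot trmx_mul mulmxA trmx_delta -colE mxE. Qed.

End Dot.

(** The algebra behind [curvature_coframe]: d stands for the common second
    derivative of the coframe, a and b for its first derivatives. *)
Lemma curvature_algebra (R : comPzRingType) n (d a b t : 'rV[R]_n) (Lu Lv P Q : 'M[R]_n) :
  d + (a *m Lv + t *m P) + (b + t *m Lv) *m Lu
  - (d + (b *m Lu + t *m Q) + (a + t *m Lu) *m Lv) =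
  t *m (P - Q + Lv *m Lu - Lu *m Lv).
Proof.
rewrite mulmxBr mulmxDr mulmxBr !mulmxDl !mulmxA.
move: (a *m Lv) (b *m Lu) (t *m P) (t *m Q) (t *m Lv *m Lu) (t *m Lu *m Lv).
by move=> x1 x2 x3 x4 x5 x6; apply/rowP => j; rewrite !mxE; ring.
Qed.

Section Coframe.
Variables (R : realType) (n : nat).
Local Notation V := 'rV[R]_n.+1.
Variables (U : set V) (g : V -> V -> V -> R).
Variables (Theta : V -> 'M[R]_n.+1) (Lambda : V -> V -> 'M[R]_n.+1).
Hypothesis Uo : open U.
Hypothesis Theta_smooth : smooth_mx U Theta.
Hypothesis Theta_unit : forall x, U x -> Theta x \in unitmx.
Hypothesis gE : forall x u v, U x -> g x u v = dot (u *m Theta x) (v *m Theta x).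
Hypothesis Lambda_smooth : forall u, smooth_mx U (Lambda ^~ u).
Hypothesis Lambda_skew : forall x u, U x -> (Lambda x u)^T = - Lambda x u.
Hypothesis Lambda_torsion_free : forall x u v, U x ->
  v *m 'D_u Theta x + v *m Theta x *m Lambda x u =
  u *m 'D_v Theta x + u *m Theta x *m Lambda x v.

(** The derivative of the metric is that of the scalar product of frame
    components; the Lambda terms added here cancel by skewness. *)
Lemma metric_compatible x u v w : U x ->
  'D_u (fun y => g y v w : R^o) x =
  dot (v *m 'D_u Theta x + v *m Theta x *m Lambda x u) (w *m Theta x) +
  dot (v *m Theta x) (w *m 'D_u Theta x + w *m Theta x *m Lambda x u).
Proof.
move=> Ux; have Td := smooth_mx_is_derive u Theta_smooth Ux.
have /is_derive_mxP/(_ 0 0) := is_derive_mulmx (is_derive_mulmxl v Td)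
  (is_derive_trmx (is_derive_mulmxl w Td)).
rewrite mxE => -[_ E].
rewrite (_ : 'D_u _ x = 'D_u (fun y => dot (v *m Theta y) (w *m Theta y) : R^o) x).
  rewrite [LHS]E -/(dot (v *m 'D_u Theta x) (w *m Theta x)).
  rewrite -/(dot (v *m Theta x) (w *m 'D_u Theta x)) dotDl dotDr.
  by rewrite (dot_skew _ _ (Lambda_skew u Ux)) addrACA [- _ + _]addNr addr0.
by apply: near_eq_derive; apply: (nearU Uo Ux) => y Uy; rewrite gE.
Qed.

(** Koszul's argument: with compatibility and symmetry, the combination of
    derivatives of the metric that defines the Christoffel symbols collapses to
    the scalar product of nabla_u v with each coordinate vector; the inverse of
    the Gram matrix Theta Theta^T recovers nabla_u v.  Components are row
    vectors, so Lambda acts on the right. *)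
Lemma christoffel_coframe x u v : U x ->
  christoffel g x u v *m Theta x = v *m 'D_u Theta x + v *m Theta x *m Lambda x u.
Proof.
move=> Ux; set nab := RHS.
have gramE : gram g x = Theta x *m (Theta x)^T.
  by apply/matrixP => i j; rewrite mxE gE // dot_delta -mulmxA -rowE mxE.
have -> : christoffel g x u v = nab *m (Theta x)^T *m invmx (gram g x).
  congr (_ *m _); apply/rowP => l; rewrite mxE -dot_delta.
  set el := delta_mx 0 l.
  pose nb (w w' : V) : V := w' *m 'D_w Theta x + w' *m Theta x *m Lambda x w.
  have tf (w w' : V) : nb w w' = nb w' w by exact: Lambda_torsion_free.
  have mc (w v' w' : V) : 'D_w (fun y => g y v' w' : R^o) x =
      dot (nb w v') (w' *m Theta x) + dot (v' *m Theta x) (nb w w').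
    exact: metric_compatible.
  rewrite (mc u) (mc v) (mc el) (tf v u) (tf el u) (tf el v) (dotC (nb u el)).
  (* p = <v, nabla_u e_l>, q = <u, nabla_v e_l> and r = <nabla_u v, e_l>. *)
  have key (p q r : R) : 2^-1 * (r + p + (r + q) - (p + q)) = r by field.
  rewrite (dotC (v *m _)); exact: key.
have TT : (Theta x)^T \in unitmx by rewrite unitmx_tr Theta_unit.
apply: (can_inj (mulmxK TT)); rewrite -[LHS]mulmxA -gramE mulmxKV //.
by rewrite gramE unitmx_mul Theta_unit.
Qed.

Lemma coframe_inj x (a b : V) : U x -> a *m Theta x = b *m Theta x -> a = b.
Proof. by move=> Ux; apply: (can_inj (mulmxK (Theta_unit Ux))). Qed.

Lemma christoffel_smooth u v : smooth_mx U (fun x => christoffel g x u v).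
Proof.
apply: (@smooth_mx_congr _ _ _ Uo _ _ (fun x =>
  (v *m 'D_u Theta x + v *m Theta x *m Lambda x u) *m invmx (Theta x))).
  by move=> x Ux; rewrite -christoffel_coframe // mulmxK // Theta_unit.
apply: smooth_mxM => //; last exact: smooth_invmx.
apply: smooth_mxD => //; repeat apply: smooth_mxM => //; try exact: smooth_mx_cst.
exact: smooth_mx_derive.
Qed.

(** On constant fields nabla_u nabla_v w has frame components
    D_u D_v (w Theta) + ..., and the second derivatives of Theta cancel by
    [smooth_mx_derive_comm].  Products of Lambda appear in reversed order because
    matrices act on the right. *)
Lemma curvature_coframe x u v w : U x ->
  curvature g x u v w *m Theta x = w *m Theta x *m
    ('D_u (Lambda ^~ v) x - 'D_v (Lambda ^~ u) x
     + Lambda x v *m Lambda x u - Lambda x u *m Lambda x v).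
Proof.
move=> Ux.
have nabla_cst p q : nabla g (cst p) (cst q) = fun y => christoffel g y p q.
  by apply/funext => y; rewrite /nabla derive_cst add0r.
have bracket0 : lie_bracket (cst u) (cst v) = cst 0 :> (V -> V).
  by apply/funext => y; rewrite /lie_bracket !derive_cst subrr.
have nabla0 : nabla g (cst 0) (cst w) x = 0.
  rewrite nabla_cst; apply: (coframe_inj Ux).
  by rewrite christoffel_coframe // Lambda_torsion_free // !mul0mx addr0.
have second p q d : 'D_p ('D_q Theta) x = d ->
    nabla g (cst p) (nabla g (cst q) (cst w)) x *m Theta x =
    w *m d
    + (w *m 'D_p Theta x *m Lambda x q + w *m Theta x *m 'D_p (Lambda ^~ q) x)
    + (w *m 'D_q Theta x + w *m Theta x *m Lambda x q) *m Lambda x p.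
  move=> <-; rewrite nabla_cst /nabla [LHS]mulmxDl (christoffel_coframe (cst p x) _ Ux) /=.
  rewrite (christoffel_coframe q w Ux) addrA; congr (_ + _).
  have Gd := smooth_mx_is_derive p (christoffel_smooth q w) Ux.
  have Td := smooth_mx_is_derive p Theta_smooth Ux.
  have Ld := smooth_mx_is_derive p (Lambda_smooth q) Ux.
  have dTd := smooth_mx_is_derive p (smooth_mx_derive Uo q Theta_smooth) Ux.
  have [_ <-] := is_derive_mulmx Gd Td.
  have [_ <-] := is_deriveD (is_derive_mulmxl w dTd)
                            (is_derive_mulmx (is_derive_mulmxl w Td) Ld).
  apply: near_eq_derive; apply: (nearU Uo Ux) => y Uy.
  by rewrite christoffel_coframe.
have -> : curvature g x u v w = nabla g (cst u) (nabla g (cst v) (cst w)) x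
    - nabla g (cst v) (nabla g (cst u) (cst w)) x.
  by rewrite /curvature /curvature_field bracket0 nabla0 subr0.
apply: etrans (mulmxBl _ _ _) _.
have comm := smooth_mx_derive_comm Uo v u Theta_smooth Ux.
apply: etrans (congr2 (fun a b => a - b) (second u v _ erefl) (second v u _ comm)) _.
exact: curvature_algebra.
Qed.

End Coframe.

(** * Covariant differentiation of invariant tensors along a geodesic *)

(** Unlike [mxE], these rules keep products of matrices folded, so that [ring] can
    treat their entries as atoms. *)
Lemma addmxE (R : pzRingType) m n (A B : 'M[R]_(m, n)) i j : (A + B) i j = A i j + B i j.
Proof. by rewrite mxE. Qed.

Lemma oppmxE (R : pzRingType) m n (A : 'M[R]_(m, n)) i j : (- A) i j = - A i j.
Proof. by rewrite mxE. Qed.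

Lemma scalemxE (R : pzRingType) m n (r : R) (A : 'M[R]_(m, n)) i j : (r *: A) i j = r * A i j.
Proof. by rewrite mxE. Qed.

Section InvariantTensors.
Variables (R : realType) (n : nat).
Local Notation V := 'rV[R]_n.+1.
Local Notation M := 'M[R]_n.+1.
Variables (isotropy : set M) (curv : V -> V -> M) (Q : V -> M).
Hypothesis curv_linl : forall b, linear (curv ^~ b).
Hypothesis curv_linr : forall a, linear (curv a).
Hypothesis curv_invariant : forall A a b, isotropy A ->
  curv a b *m A = A *m curv a b + curv (a *m A) b + curv a (b *m A).
Hypothesis Q_lin : linear Q.
Hypothesis Q_invariant : forall A x, isotropy A -> Q x *m A = A *m Q x + Q (x *m A).

(** [jet k x] is the k-fold image of the curvature tensor d, a, b |-> R(a,b)d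
    under the derivation of (1,3)-tensors induced by the endomorphism Q x: this
    is what k covariant derivatives along a geodesic of velocity x amount to. *)
Fixpoint jet (k : nat) (x a b d : V) {struct k} : V :=
  if k is k'.+1 then
    jet k' x a b d *m Q x - jet k' x (a *m Q x) b d
    - jet k' x a (b *m Q x) d - jet k' x a b (d *m Q x)
  else d *m curv a b.

Lemma jet_linear1 k x b d : linear (fun a => jet k x a b d).
Proof.
elim: k b d => [|k IH] b d r a a' /=.
  by rewrite curv_linl mulmxDr scalemxAr.
rewrite !mulmxDl -!scalemxAl !IH mulmxDl -scalemxAl.
by rewrite !scalerBr !opprD !addrA; apply/rowP => j; rewrite !(addmxE, oppmxE, scalemxE); ring.
Qed.

Lemma jet_linear2 k x a d : linear (fun b => jet k x a b d).
Proof.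
elim: k a d => [|k IH] a d r b b' /=.
  by rewrite curv_linr mulmxDr scalemxAr.
rewrite !mulmxDl -!scalemxAl !IH mulmxDl -scalemxAl.
by rewrite !scalerBr !opprD !addrA; apply/rowP => j; rewrite !(addmxE, oppmxE, scalemxE); ring.
Qed.

Lemma jet_linear3 k x a b : linear (jet k x a b).
Proof.
elim: k a b => [|k IH] a b r d d' /=.
  by rewrite mulmxDl scalemxAl.
rewrite !mulmxDl -!scalemxAl !IH mulmxDl -scalemxAl.
by rewrite !scalerBr !opprD !addrA; apply/rowP => j; rewrite !(addmxE, oppmxE, scalemxE); ring.
Qed.

(** Write D p = p' + p A for the covariant derivative with respect to the isotropy
    part A of the connection.  If D x = 0, invariance under the isotropy algebra
    gives the Leibniz rule D(jet(x; a, b, d)) = jet(x; D a, b, d) + ... with no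
    term from x, whatever the degree of the jet in x. *)
Lemma is_derive_jet k (x a b d : R^o -> V) (t : R^o) (A : M) (da db dd : V) :
  isotropy A ->
  is_derive t 1 x (- (x t *m A)) ->
  is_derive t 1 a da -> is_derive t 1 b db -> is_derive t 1 d dd ->
  is_derive t 1 (fun s => jet k (x s) (a s) (b s) (d s))
    (jet k (x t) (da + a t *m A) (b t) (d t)
     + jet k (x t) (a t) (db + b t *m A) (d t)
     + jet k (x t) (a t) (b t) (dd + d t *m A)
     - jet k (x t) (a t) (b t) (d t) *m A).
Proof.
move=> hA xd; elim: k a b d da db dd => [|k IH] a b d da db dd ad bd dd'.
  have key : (dd *m curv (a t) (b t) + d t *m (curv da (b t) + curv (a t) db)) = 
    (jet 0 (x t) (da + a t *m A) (b t) (d t)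
     + jet 0 (x t) (a t) (db + b t *m A) (d t)
     + jet 0 (x t) (a t) (b t) (dd + d t *m A)
     - jet 0 (x t) (a t) (b t) (d t) *m A).
    rewrite /= -(mulmxA (d t) _ A) (curv_invariant _ _ hA).
    have := curv_linl (b t) 1 da (a t *m A); rewrite !scale1r => ->.
    have := curv_linr (a t) 1 db (b t *m A); rewrite !scale1r => ->.
    by rewrite !mulmxDr !mulmxDl !mulmxA; apply/rowP => j; rewrite !(addmxE, oppmxE); ring.
  rewrite -key; apply: (is_derive_mulmx dd').
  exact: (is_derive_bilinear curv_linl curv_linr ad bd).
have Qd : is_derive t 1 (fun s => Q (x s)) (Q (- (x t *m A))).
  exact: is_derive_linear.
have QN : Q (- (x t *m A)) = A *m Q (x t) - Q (x t) *m A.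
  have Q0 : Q 0 = 0 by have := Q_lin (-1) 0 0; rewrite scaler0 addr0 scaleN1r addNr.
  have := Q_lin (-1) (x t *m A) 0; rewrite Q0 !addr0 !scaleN1r => ->.
  by rewrite (Q_invariant _ hA) opprD addrA addrN sub0r.
have aQ := is_derive_mulmx ad Qd; have bQ := is_derive_mulmx bd Qd.
have dQ := is_derive_mulmx dd' Qd.
have J := is_derive_mulmx (IH _ _ _ _ _ _ ad bd dd') Qd.
have J1 := IH _ _ _ _ _ _ aQ bd dd'.
have J2 := IH _ _ _ _ _ _ ad bQ dd'.
have J3 := IH _ _ _ _ _ _ ad bd dQ.
have := is_deriveB (is_deriveB (is_deriveB J J1) J2) J3.
have cov (p dp : V) :
    dp *m Q (x t) + p *m (Q (- (x t *m A))) + p *m Q (x t) *m A = (dp + p *m A) *m Q (x t).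
  by rewrite QN mulmxBr mulmxDl !mulmxA -!addrA addNr addr0.
rewrite /= !cov QN.
move=> H; apply: is_derive_eq H _.
rewrite !mulmxBr !mulmxBl !mulmxDl !mulmxA.
by apply/rowP => j; rewrite !(addmxE, oppmxE); ring.
Qed.

End InvariantTensors.

Section GeodesicJets.
Variables (R : realType) (n : nat).
Local Notation V := 'rV[R]_n.+1.
Local Notation M := 'M[R]_n.+1.
Variables (isotropy : set M) (curv : V -> V -> M) (Q : V -> M).
Hypothesis curv_linl : forall b, linear (curv ^~ b).
Hypothesis curv_linr : forall a, linear (curv a).
Hypothesis curv_invariant : forall A a b, isotropy A ->
  curv a b *m A = A *m curv a b + curv (a *m A) b + curv a (b *m A).
Hypothesis Q_lin : linear Q.
Hypothesis Q_invariant : forall A x, isotropy A -> Q x *m A = A *m Q x + Q (x *m A).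
Hypothesis Q_alt : forall x, x *m Q x = 0.

Variables (U : set V) (g : V -> V -> V -> R).
Variables (Theta : V -> M) (H : V -> V -> M).
Hypothesis Uo : open U.
Hypothesis Theta_smooth : smooth_mx U Theta.
Hypothesis Theta_unit : forall x, U x -> Theta x \in unitmx.
Hypothesis H_isotropy : forall x u, U x -> isotropy (H x u).
Hypothesis christoffelE : forall x u v, U x ->
  christoffel g x u v *m Theta x =
  v *m 'D_u Theta x + v *m Theta x *m (H x u + Q (u *m Theta x)).
Hypothesis curvatureE : forall x u v w, U x ->
  curvature g x u v w *m Theta x = w *m Theta x *m curv (u *m Theta x) (v *m Theta x).

Variables (W : set R^o) (c : R -> V).
Hypothesis Wo : open W.
Hypothesis cW : forall t, W t -> U (c t).
Hypothesis c_derive : forall t : R, W t ->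
  is_derive (t : R^o) 1 (c : R^o -> V) (derive1 c t).
Hypothesis c_derive2 : forall t : R, W t ->
  is_derive (t : R^o) 1 (derive1 c : R^o -> V) (derive1n 2 c t).
Hypothesis c_geodesic : forall t, W t -> acceleration g c t = 0.

Let X t := derive1 c t *m Theta (c t).

Lemma is_derive_Theta_curve t : W t ->
  is_derive (t : R^o) 1 (fun s => Theta (c s)) ('D_(derive1 c t) Theta (c t)).
Proof.
move=> Wt; apply: is_derive_comp_curve (c_derive Wt).
exact: (smooth_mx_differentiable Theta_smooth (cW Wt)).
Qed.

(** The geodesic equation in the frame; the half bracket [x,x]_m drops out. *)
Lemma is_derive_velocity t : W t ->
  is_derive (t : R^o) 1 X (- (X t *m H (c t) (derive1 c t))).
Proof.
move=> Wt; have XX := is_derive_mulmx (c_derive2 Wt) (is_derive_Theta_curve Wt).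
have := congr1 (mulmx^~ (Theta (c t))) (c_geodesic Wt).
rewrite /acceleration /= mulmxDl mul0mx (christoffelE _ _ (cW Wt)) -/(X t).
rewrite mulmxDr Q_alt addr0 addrA => /eqP; rewrite addr_eq0 => /eqP <-.
exact: XX.
Qed.

(** The connection is H + Q x.  The derivative of the coframe and the isotropy
    part H are accounted for by [is_derive_jet]; what remains is the derivation
    induced by Q x. *)
Lemma cov_deriv_jet k T t u v w : W t ->
  (forall s u v w, W s -> T s u v w *m Theta (c s) =
     jet curv Q k (X s) (u *m Theta (c s)) (v *m Theta (c s)) (w *m Theta (c s))) ->
  cov_deriv_along g c T t u v w *m Theta (c t) =
  jet curv Q k.+1 (X t) (u *m Theta (c t)) (v *m Theta (c t)) (w *m Theta (c t)).
Proof.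
move=> Wt TE; have Ut := cW Wt.
have Td := is_derive_Theta_curve Wt; set dT := 'D_(_) Theta _ in Td.
set A := H (c t) (derive1 c t).
pose th (p : V) (s : R^o) : V := p *m Theta (c s).
have thd (p : V) : is_derive (t : R^o) 1 (th p) (p *m dT) := is_derive_mulmxl p Td.
pose Y (s : R^o) : V := jet curv Q k (X s) (th u s) (th v s) (th w s).
have Yd := is_derive_jet curv_linl curv_linr curv_invariant Q_lin Q_invariant k
  (H_isotropy (derive1 c t) Ut) (is_derive_velocity Wt) (thd u) (thd v) (thd w).
rewrite -/A in Yd; set dY := (X in is_derive _ _ _ X) in Yd.
have Ivd : is_derive (t : R^o) 1 (fun s => invmx (Theta (c s)))
    ('D_(derive1 c t) (fun x => invmx (Theta x)) (c t)).
  apply: is_derive_comp_curve (c_derive Wt).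
  exact: (smooth_mx_differentiable (smooth_invmx Uo Theta_smooth Theta_unit) Ut).
(* T is differentiable because it is Y times the inverse of the coframe. *)
have TuE : \forall s \near (t : R^o), Y s *m invmx (Theta (c s)) = T s u v w.
  apply: (nearU Wo Wt) => s Ws.
  by rewrite /Y /th -TE // mulmxK //; exact: Theta_unit (cW Ws).
have [Tud _] := near_eq_is_derive TuE (is_derive_mulmx Yd Ivd).
have TTd := is_derive_mulmx (derivableP Tud) Td.
have YE : \forall s \near (t : R^o), T s u v w *m Theta (c s) = Y s.
  by apply: (nearU Wo Wt) => s Ws; rewrite TE.
have dTE : derive1 (fun s => T s u v w) t *m Theta (c t) + T t u v w *m dT = dY.
  have [_ E1] := near_eq_is_derive YE TTd; have [_ E2] := Yd.
  by rewrite derive1E -[RHS]E2 -[LHS]E1.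
have GE p : christoffel g (c t) (derive1 c t) p *m Theta (c t) =
    p *m dT + p *m Theta (c t) *m A + p *m Theta (c t) *m Q (X t).
  by rewrite christoffelE // mulmxDr addrA.
move: dTE GE; rewrite /cov_deriv_along /=.
move: (derive1 _ t) (christoffel g _ _) => D G dTE GE.
rewrite !mulmxBl mulmxDl !(TE t) // !GE TE //.
rewrite -(addrA (T t u v w *m dT)) [X in X - _ - _ - _]addrA dTE.
have add1 := jet_linear1 Q curv_linl k (X t).
have add2 := jet_linear2 Q curv_linr k (X t).
have add3 := jet_linear3 curv Q k (X t).
have sp f a b : linear (f : V -> V) -> f (a + b) = f a + f b.
  by move=> fl; have := fl 1 a b; rewrite !scale1r.
rewrite (sp _ _ _ (add1 _ _)) (sp _ _ _ (add2 _ _)) (sp _ _ _ (add3 _ _)).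
rewrite /dY /= -/(th u t) -/(th v t) -/(th w t).
by apply/rowP => j; rewrite !(addmxE, oppmxE); ring.
Qed.

Lemma jacobi_deriv_jet k t v : W t ->
  jacobi_deriv g c k t v *m Theta (c t) =
  jet curv Q k (X t) (v *m Theta (c t)) (X t) (X t).
Proof.
move=> Wt; rewrite /jacobi_deriv.
have : forall s u v w, W s ->
    iter k (cov_deriv_along g c) (fun s => curvature g (c s)) s u v w *m Theta (c s) =
    jet curv Q k (X s) (u *m Theta (c s)) (v *m Theta (c s)) (w *m Theta (c s)).
  elim: k => [|k IH] s u v' w Ws; first by rewrite /= (curvatureE _ _ _ (cW Ws)).
  exact: (cov_deriv_jet _ _ _ Ws IH).
by move=> E; rewrite E.
Qed.

End GeodesicJets.

(** * Iterated derivatives of the Jacobi operator for a cross product *)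

Section CrossProductJets.
Variables (R : realType) (n : nat).
Local Notation V := 'rV[R]_n.+1.
Local Notation M := 'M[R]_n.+1.
Variables (curv : V -> V -> M) (Q : V -> M).
Hypothesis curv_linl : forall b, linear (curv ^~ b).
Hypothesis curv_linr : forall a, linear (curv a).
Hypothesis curv_skew : forall a b, (curv a b)^T = - curv a b.
Hypothesis curv_alt : forall a, curv a a = 0.
Hypothesis Q_alt : forall x, x *m Q x = 0.
Hypothesis Q_cross : forall x a,
  a *m Q x *m Q x = 4^-1 *: (dot a x *: x - dot x x *: a).

(** With both last arguments equal to x only two terms survive, since x Q(x) = 0:
    the derivation acts on the Jacobi operator as a commutator with Q x. *)
Lemma jet_diagonal k x a :
  jet curv Q k.+1 x a x x = jet curv Q k x a x x *m Q x - jet curv Q k x (a *m Q x) x x.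
Proof.
have lin0 (f : V -> V) : linear f -> f 0 = 0.
  by move=> fl; have := fl (-1) 0 0; rewrite scaler0 addr0 scaleN1r addNr.
rewrite /= Q_alt (lin0 _ (jet_linear2 Q curv_linr k x a x)).
by rewrite (lin0 _ (jet_linear3 curv Q k x a x)) !subr0.
Qed.

(** Q(x)^2 is - |x|^2 / 4 modulo x.  The Jacobi operator J kills x, by
    antisymmetry of the curvature, and takes values orthogonal to x, by its
    skewness, so in the third commutator both J(a) Q^2 and J(a Q^2) equal
    - |x|^2 / 4 J(a). *)
Lemma jet3_diagonal x a :
  jet curv Q 3 x a x x = - (dot x x *: jet curv Q 1 x a x x).
Proof.
rewrite !jet_diagonal; pose J a := jet curv Q 0 x a x x.
have Jl r a1 a2 : J (r *: a1 + a2) = r *: J a1 + J a2 by exact: jet_linear1.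
have Jx : J x = 0 by rewrite /J /= curv_alt mulmx0.
have JZ r a1 : J (r *: a1) = r *: J a1.
  have J0 : J 0 = 0 by have := Jl (-1) 0 0; rewrite scaler0 addr0 scaleN1r addNr.
  by rewrite -[r *: a1]addr0 Jl J0 addr0.
have JN a1 : J (- a1) = - J a1 by rewrite -scaleN1r JZ scaleN1r.
have J_orth b : dot (J b) x = 0 by rewrite /J /=; exact: dot_skew0.
have JQQ b : J b *m Q x *m Q x = - ((4^-1 * dot x x) *: J b).
  by rewrite Q_cross J_orth scale0r sub0r scalerN scalerA.
have JQQ' b : J (b *m Q x *m Q x) = - ((4^-1 * dot x x) *: J b).
  by rewrite Q_cross JZ Jl Jx scaler0 add0r JN JZ scalerN scalerA.
rewrite -/(J a) -/(J (a *m Q x)) -/(J (a *m Q x *m Q x)).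
rewrite -/(J (a *m Q x *m Q x *m Q x)).
rewrite !mulmxBl !JQQ !JQQ' mulNmx -scalemxAl.
by apply/rowP => j; rewrite !(addmxE, oppmxE, scalemxE); field.
Qed.

Lemma jet4_diagonal x a :
  jet curv Q 4 x a x x = - (dot x x *: jet curv Q 2 x a x x).
Proof.
rewrite jet_diagonal !jet3_diagonal (jet_diagonal 1).
rewrite mulNmx -scalemxAl.
by apply/rowP => j; rewrite !(addmxE, oppmxE, scalemxE); ring.
Qed.

End CrossProductJets.

(** * The Lie algebra sp(2) in coordinates *)

Section Sp2Algebra.
Local Open Scope complex_scope.
Variable R : realType.
Local Notation C := R[i].
Local Notation C4 := 'M[R[i]]_4.

(** Four-by-four matrices given by a function on indices, so that products and
    traces compute. *)
Definition mx4 (f : nat -> nat -> C) : C4 := \matrix_(i, j) f i j.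

Lemma mx4_ext f g :
  (forall i j : nat, (i < 4)%N -> (j < 4)%N -> f i j = g i j) -> mx4 f = mx4 g.
Proof. by move=> fg; apply/matrixP => i j; rewrite !mxE fg. Qed.

Lemma mx4_mul f g : mx4 f *m mx4 g =
  mx4 (fun i j => f i 0%N * g 0%N j + f i 1%N * g 1%N j + f i 2%N * g 2%N j + f i 3%N * g 3%N j).
Proof.
by apply/matrixP => i j; rewrite !mxE !big_ord_recl big_ord0 !mxE /= addr0 !addrA.
Qed.

Lemma mx4_trace f : \tr (mx4 f) = (f 0%N 0%N + f 1%N 1%N + f 2%N 2%N + f 3%N 3%N).
Proof. by rewrite /mxtrace !big_ord_recl big_ord0 !mxE /= addr0 !addrA. Qed.

Lemma mx4E (A : C4) : A = mx4 (fun i j => A (inord i) (inord j)).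
Proof. by apply/matrixP => i j; rewrite mxE !inord_val. Qed.

Lemma Emx4 k l : (0 < k < 5)%N -> (0 < l < 5)%N ->
  Emx R k l = mx4 (fun i j => ((i == k.-1) && (j == l.-1))%:R).
Proof.
move=> hk hl; apply/matrixP => i j; rewrite !mxE -!val_eqE /= !inordK //.
  by case: l hl => // l /andP[].
by case: k hk => // k /andP[].
Qed.

(** Entries of the matrix x_1 S_1 + ... + x_10 S_10. *)
Definition spfun (x : nat -> R) (i j : nat) : C :=
  match i, j with
  | 0%N, 0%N => 0 +i* x 1%N    | 0%N, 1%N => x 3%N +i* x 4%N
  | 0%N, 2%N => x 7%N +i* x 8%N  | 0%N, 3%N => x 9%N +i* x 10%N
  | 1%N, 0%N => (- x 3%N) +i* x 4%N | 1%N, 1%N => 0 +i* (- x 1%N)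
  | 1%N, 2%N => x 9%N +i* (- x 10%N) | 1%N, 3%N => (- x 7%N) +i* x 8%N
  | 2%N, 0%N => (- x 7%N) +i* x 8%N | 2%N, 1%N => (- x 9%N) +i* (- x 10%N)
  | 2%N, 2%N => 0 +i* x 2%N | 2%N, 3%N => x 5%N +i* x 6%N
  | 3%N, 0%N => (- x 9%N) +i* x 10%N | 3%N, 1%N => x 7%N +i* x 8%N
  | 3%N, 2%N => (- x 5%N) +i* x 6%N | 3%N, 3%N => 0 +i* (- x 2%N)
  | _, _ => 0
  end.

Definition spmx x := mx4 (spfun x).

Definition spmx_bracket_coef (x y : nat -> R) (k : nat) : R :=
  match k with
  | 1%N => 2 * (x 3%N * y 4%N - x 4%N * y 3%N) + 2 * (x 7%N * y 8%N - x 8%N * y 7%N)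
      + 2 * (x 9%N * y 10%N - x 10%N * y 9%N)
  | 2%N => 2 * (x 5%N * y 6%N - x 6%N * y 5%N) + (-2) * (x 7%N * y 8%N - x 8%N * y 7%N)
      + 2 * (x 9%N * y 10%N - x 10%N * y 9%N)
  | 3%N => (-2) * (x 1%N * y 4%N - x 4%N * y 1%N) + (-2) * (x 7%N * y 9%N - x 9%N * y 7%N)
      + 2 * (x 8%N * y 10%N - x 10%N * y 8%N)
  | 4%N => 2 * (x 1%N * y 3%N - x 3%N * y 1%N) + (-2) * (x 7%N * y 10%N - x 10%N * y 7%N)
      + (-2) * (x 8%N * y 9%N - x 9%N * y 8%N)
  | 5%N => (-2) * (x 2%N * y 6%N - x 6%N * y 2%N) + (-2) * (x 7%N * y 9%N - x 9%N * y 7%N)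
      + (-2) * (x 8%N * y 10%N - x 10%N * y 8%N)
  | 6%N => 2 * (x 2%N * y 5%N - x 5%N * y 2%N) + (-2) * (x 7%N * y 10%N - x 10%N * y 7%N)
      + 2 * (x 8%N * y 9%N - x 9%N * y 8%N)
  | 7%N => (-1) * (x 1%N * y 8%N - x 8%N * y 1%N) + (x 2%N * y 8%N - x 8%N * y 2%N)
      + (x 3%N * y 9%N - x 9%N * y 3%N) + (x 4%N * y 10%N - x 10%N * y 4%N) + (x 5%N * y 9%N
      - x 9%N * y 5%N) + (x 6%N * y 10%N - x 10%N * y 6%N)
  | 8%N => (x 1%N * y 7%N - x 7%N * y 1%N) + (-1) * (x 2%N * y 7%N - x 7%N * y 2%N)
      + (-1) * (x 3%N * y 10%N - x 10%N * y 3%N) + (x 4%N * y 9%N - x 9%N * y 4%N)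
      + (x 5%N * y 10%N - x 10%N * y 5%N) + (-1) * (x 6%N * y 9%N - x 9%N * y 6%N)
  | 9%N => (-1) * (x 1%N * y 10%N - x 10%N * y 1%N) + (-1) * (x 2%N * y 10%N - x 10%N * y 2%N)
      + (-1) * (x 3%N * y 7%N - x 7%N * y 3%N) + (-1) * (x 4%N * y 8%N - x 8%N * y 4%N)
      + (-1) * (x 5%N * y 7%N - x 7%N * y 5%N) + (x 6%N * y 8%N - x 8%N * y 6%N)
  | 10%N => (x 1%N * y 9%N - x 9%N * y 1%N) + (x 2%N * y 9%N - x 9%N * y 2%N) + (x 3%N * y 8%N
      - x 8%N * y 3%N) + (-1) * (x 4%N * y 7%N - x 7%N * y 4%N) + (-1) * (x 5%N * y 8%N
      - x 8%N * y 5%N) + (-1) * (x 6%N * y 7%N - x 7%N * y 6%N)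
  | _ => 0
  end.

Definition bracket (A B : C4) : C4 := A *m B - B *m A.

Lemma mx4_sub f g : mx4 f - mx4 g = mx4 (fun i j => f i j - g i j).
Proof. by apply/matrixP => i j; rewrite !mxE. Qed.

Lemma mx4_add f g : mx4 f + mx4 g = mx4 (fun i j => f i j + g i j).
Proof. by apply/matrixP => i j; rewrite !mxE. Qed.

Lemma mx4_scale c f : c *: mx4 f = mx4 (fun i j => c * f i j).
Proof. by apply/matrixP => i j; rewrite !mxE. Qed.

Lemma bracket_spmx x y : bracket (spmx x) (spmx y) = spmx (spmx_bracket_coef x y).
Proof.
rewrite /bracket /spmx !mx4_mul mx4_sub; apply: mx4_ext => i j.
case: i => [|[|[|[|//]]]] _; case: j => [|[|[|[|//]]]] _ /=;
  apply/eqP; rewrite eq_complex /=; apply/andP; split; apply/eqP; ring.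
Qed.

Lemma ip_spmx x y : ip (spmx x) (spmx y) =
  5^-1 * (2 * (x 1%N * y 1%N + x 2%N * y 2%N + x 3%N * y 3%N + x 4%N * y 4%N + x 5%N * y 5%N
      + x 6%N * y 6%N)
  + 4 * (x 7%N * y 7%N + x 8%N * y 8%N + x 9%N * y 9%N + x 10%N * y 10%N)).
Proof.
by rewrite /ip /spmx !mx4_mul mx4_trace /=; field.
Qed.

(** Coordinates on S_1, ..., S_10 of the matrix a_1 Q_1 + ... + a_10 Q_10. *)
Definition Qcoef (a : nat -> R) (k : nat) : R :=
  match k with
  | 1%N => a 1%N / 2 + a 8%N * (3 / 2)
  | 2%N => - (a 1%N * (3 / 2)) + a 8%N / 2
  | 3%N => a 2%N * Num.sqrt (5 / 2)
  | 4%N => a 3%N * Num.sqrt (5 / 2)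
  | 5%N => a 4%N * (Num.sqrt 6 / 2) + a 9%N
  | 6%N => a 5%N * (Num.sqrt 6 / 2) + a 10%N
  | 7%N => - (a 4%N * (Num.sqrt 2 / 2)) + a 9%N * (Num.sqrt 3 / 2)
  | 8%N => - (a 5%N * (Num.sqrt 2 / 2)) + a 10%N * (Num.sqrt 3 / 2)
  | 9%N => a 6%N * (Num.sqrt 5 / 2)
  | 10%N => a 7%N * (Num.sqrt 5 / 2)
  | _ => 0
  end.

Lemma sum10 (W : nmodType) (F : nat -> W) : \sum_(1 <= k < 11) F k =
  F 1%N + F 2%N + F 3%N + F 4%N + F 5%N + F 6%N + F 7%N + F 8%N + F 9%N + F 10%N.
Proof. by rewrite /index_iota subn1 /= !big_cons big_nil addr0 !addrA. Qed.

Lemma Qsum a : \sum_(1 <= k < 11) (a k)%:C *: Qmx R k = spmx (Qcoef a).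
Proof.
rewrite sum10 /Qmx /Smx !Emx4 //.
rewrite !(mx4_scale, mx4_sub, mx4_add); apply: mx4_ext => i j.
case: i => [|[|[|[|//]]]] _; case: j => [|[|[|[|//]]]] _ /=;
  apply/eqP; rewrite eq_complex /=; apply/andP; split; apply/eqP; by field.
Qed.

Definition kron (k l : nat) : R := (k == l)%:R.

Lemma Qmx_spmx k : (0 < k < 11)%N -> Qmx R k = spmx (Qcoef (kron k)).
Proof.
move=> hk; rewrite -Qsum (bigD1_seq k) ?iota_uniq ?mem_index_iota //=.
rewrite /kron eqxx scale1r big1 ?addr0 // => l lk.
by rewrite eq_sym (negbTE lk) scale0r.
Qed.

(** All the roots occurring in the Q_k lie in the field generated by the roots of 2,
    3 and 5; expressing them so turns later identities into polynomial ones. *)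
Lemma sqrt_relations : exists s5 s3 s2 : R,
  [/\ Num.sqrt (5 / 2) = s2 * s5 / 2,
      [/\ Num.sqrt 6 = s2 * s3, Num.sqrt 5 = s5, Num.sqrt 3 = s3 & Num.sqrt 2 = s2] &
      [/\ s5 ^+ 2 = 5, s3 ^+ 2 = 3 & s2 ^+ 2 = 2]].
Proof.
have sqr (u : R) : 0 <= u -> Num.sqrt u ^+ 2 = u by exact: sqr_sqrtr.
exists (Num.sqrt 5), (Num.sqrt 3), (Num.sqrt 2).
split; [|split=> //|by split; rewrite sqr].
  rewrite -[RHS]ger0_norm ?divr_ge0 ?mulr_ge0 ?sqrtr_ge0 // -sqrtr_sqr.
  by rewrite !exprMn !sqr //; congr Num.sqrt; field.
by rewrite -sqrtrM // -natrM.
Qed.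

Lemma ip_Qcoef a b : ip (spmx (Qcoef a)) (spmx (Qcoef b)) = \sum_(1 <= k < 11) a k * b k.
Proof.
rewrite ip_spmx sum10 /=.
have [s5 [s3 [s2 [-> [-> -> -> ->] [h5 h3 h2]]]]] := sqrt_relations.
by field: h5 h3 h2.
Qed.

(** The defining equations of the Lie algebra of [Sp2]. *)
Definition sp (A : C4) : Prop :=
  (map_mx (@conjc R) A)^T + A = 0 /\ A^T *m symplJ R + symplJ R *m A = 0.

(** Skew-Hermitian symmetry and the symplectic relation express all sixteen
    entries through the first row and the entries (3,3) and (3,4). *)
Lemma sp_spmx A : sp A -> exists x, A = spmx x.
Proof.
rewrite (mx4E A); set f := fun i j => _; move=> [H1 H2].
have E1 i j : (i < 4)%N -> (j < 4)%N -> conjc (f j i) + f i j = 0.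
  move=> hi hj; have := congr1 (fun M : C4 => M (inord i) (inord j)) H1.
  by rewrite !mxE !inordK.
move: H2; rewrite /symplJ !Emx4 // !(mx4_sub, mx4_add).
have -> : (mx4 f)^T = mx4 (fun i j => f j i) by apply/matrixP => i j; rewrite !mxE.
rewrite !mx4_mul !(mx4_sub, mx4_add) => H2.
have {H2}E2 i j : (i < 4)%N -> (j < 4)%N -> mx4 _ (inord i) (inord j) = 0 :=
  fun hi hj => etrans (congr1 (fun M : C4 => M (inord i) (inord j)) H2) (mxE _ _ _ _).
have E1' i j : (i < 4)%N -> (j < 4)%N -> f i j = - conjc (f j i).
  by move=> hi hj; apply/eqP; rewrite -addr_eq0 addrC E1.
have f11 : f 1%N 1%N = - f 0%N 0%N.
  by apply/eqP; rewrite -addr_eq0 -(E2 0%N 1%N) // mxE !inordK //=; apply/eqP; ring.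
have f33 : f 3%N 3%N = - f 2%N 2%N.
  apply/eqP; rewrite -addr_eq0 -oppr_eq0 -(E2 2%N 3%N) // mxE !inordK //=.
  by apply/eqP; ring.
have f12 : f 1%N 2%N = - f 3%N 0%N.
  by apply/eqP; rewrite -addr_eq0 -(E2 0%N 2%N) // mxE !inordK //=; apply/eqP; ring.
have f13 : f 1%N 3%N = f 2%N 0%N.
  by apply/eqP; rewrite -subr_eq0 -(E2 0%N 3%N) // mxE !inordK //=; apply/eqP; ring.
have f31 : f 3%N 1%N = f 0%N 2%N.
  by apply/eqP; rewrite -subr_eq0 -(E2 1%N 2%N) // mxE !inordK //=; apply/eqP; ring.
have f21 : f 2%N 1%N = - f 0%N 3%N.
  apply/eqP; rewrite -addr_eq0 -oppr_eq0 -(E2 1%N 3%N) // mxE !inordK //=.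
  by apply/eqP; ring.
exists (nth 0 [:: 0; complex.Im (f 0%N 0%N); complex.Im (f 2%N 2%N);
  complex.Re (f 0%N 1%N); complex.Im (f 0%N 1%N);
  complex.Re (f 2%N 3%N); complex.Im (f 2%N 3%N);
  complex.Re (f 0%N 2%N); complex.Im (f 0%N 2%N);
  complex.Re (f 0%N 3%N); complex.Im (f 0%N 3%N)]).
have re0 i : (i < 4)%N -> complex.Re (f i i) = 0.
  move=> hi; have := congr1 (@complex.Re R) (E1 i i hi hi).
  case: (f i i) => p q /=; lra.
have r0 := re0 0%N isT; have r2 := re0 2%N isT.
have f10 := E1' 1%N 0%N isT isT; have f20 := E1' 2%N 0%N isT isT.
have f30 := E1' 3%N 0%N isT isT; have f32 := E1' 3%N 2%N isT isT.
apply: mx4_ext => i j.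
case: i => [|[|[|[|//]]]] _; case: j => [|[|[|[|//]]]] _ /=;
  rewrite ?(f11, f33, f12, f13, f31, f21, f10, f20, f30, f32);
  apply/eqP; rewrite eq_complex; move: r0 r2;
  case: (f 0%N 0%N) => p1 q1; case: (f 0%N 1%N) => p2 q2;
  case: (f 0%N 2%N) => p3 q3; case: (f 0%N 3%N) => p4 q4;
  case: (f 2%N 2%N) => p5 q5; case: (f 2%N 3%N) => p6 q6 /= e1 e5;
  by rewrite ?e1 ?e5 ?opprK ?oppr0 !eqxx.
Qed.

(** The coordinates of the witness are the inner products with Q_1, ..., Q_10. *)
Lemma spmx_Qcoef x : exists a, spmx x = spmx (Qcoef a).
Proof.
pose r (k : R) := Num.sqrt k.
exists (nth 0 [:: 0; 2 / 5 * (x 1%N / 2 - 3 / 2 * x 2%N);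
  2 / 5 * r (5 / 2) * x 3%N; 2 / 5 * r (5 / 2) * x 4%N;
  r 6 / 5 * x 5%N - 2 / 5 * r 2 * x 7%N;
  r 6 / 5 * x 6%N - 2 / 5 * r 2 * x 8%N;
  2 / 5 * r 5 * x 9%N; 2 / 5 * r 5 * x 10%N;
  2 / 5 * (3 / 2 * x 1%N + x 2%N / 2);
  2 / 5 * x 5%N + 2 / 5 * r 3 * x 7%N;
  2 / 5 * x 6%N + 2 / 5 * r 3 * x 8%N]).
rewrite {}/r.
have [s5 [s3 [s2 [r52 [r6 r5 r3 r2] [h5 h3 h2]]]]] := sqrt_relations.
apply: mx4_ext => i j hi hj; rewrite /spfun /Qcoef /= r52 r6 r5 r3 r2.
move: i j hi hj => [|[|[|[|//]]]] [|[|[|[|//]]]] _ _; apply/eqP; rewrite eq_complex /=;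
  apply/andP; split; apply/eqP; by field: h5 h3 h2.
Qed.

Lemma sp_expand A : sp A -> A = \sum_(1 <= k < 11) (ip A (Qmx R k))%:C *: Qmx R k.
Proof.
move=> /sp_spmx[x ->]; have [a ->] := spmx_Qcoef x.
rewrite -[LHS]Qsum; apply: eq_big_nat => k hk; congr (_%:C *: _).
rewrite Qmx_spmx // ip_Qcoef (bigD1_seq k) ?iota_uniq ?mem_index_iota //=.
rewrite /kron eqxx mulr1 big1 ?addr0 // => l lk.
by rewrite eq_sym (negbTE lk) mulr0.
Qed.

End Sp2Algebra.

(** * The splitting of sp(2) *)

(* Folded from here on: unification would expand sums of matrices into entries. *)
#[local] Opaque Qmx.

(** Stated for an arbitrary sequence, to be used without unfolding its terms. *)
Lemma sum_1_8 (W : nmodType) (F : nat -> W) :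
  \sum_(1 <= k < 8) F k = \sum_(k < 7) F k.+1.
Proof. by rewrite big_add1 big_mkord. Qed.

Lemma sum_8_11 (W : zmodType) (F : nat -> W) :
  \sum_(1 <= k < 11) F k - \sum_(1 <= k < 8) F k = F 8%N + F 9%N + F 10%N.
Proof.
rewrite (@big_cat_nat _ _ _ 8) //= addrAC subrr add0r.
by rewrite /index_iota /= !big_cons big_nil addr0 addrA.
Qed.

Section IsotropySplitting.
Local Open Scope complex_scope.
Variable R : realType.
Local Notation C4 := 'M[R[i]]_4.
Implicit Types (A B C W X Y : C4).

Lemma ipDl A B C : ip (A + B) C = ip A C + ip B C.
Proof. by rewrite /ip mulmxDl mxtraceD raddfD /= mulrDr. Qed.

Lemma ipZl (r : R) A C : ip (r%:C *: A) C = r * ip A C.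
Proof.
rewrite /ip -scalemxAl mxtraceZ; case: (\tr _) => u v /=; ring.
Qed.

Lemma ip_comb3_eq0 (a b c : R) A B C D : ip A D = 0 -> ip B D = 0 -> ip C D = 0 ->
  ip (a%:C *: A + b%:C *: B + c%:C *: C) D = 0.
Proof. by move=> A0 B0 C0; rewrite 2!ipDl !ipZl A0 B0 C0 !mulr0 !addr0. Qed.

Lemma ipC A B : ip A B = ip B A.
Proof. by rewrite /ip mxtrace_mulC. Qed.

Lemma ipNl A C : ip (- A) C = - ip A C.
Proof.
have -> : - A = (-1)%:C *: A by rewrite rmorphN1 scaleN1r.
by rewrite ipZl mulN1r.
Qed.

Lemma ip0l C : ip 0 C = 0.
Proof. by have := ipZl 0 0 C; rewrite scaler0 mul0r. Qed.

Lemma ip_suml (I : Type) (r : seq I) (P : pred I) (F : I -> C4) C :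
  ip (\sum_(i <- r | P i) F i) C = \sum_(i <- r | P i) ip (F i) C.
Proof.
by elim/big_rec2: _ => [|i y1 y2 _ <-]; [exact: ip0l|rewrite ipDl].
Qed.

Lemma bracketDl A B C : bracket (A + B) C = bracket A C + bracket B C.
Proof. by rewrite /bracket mulmxDl mulmxDr opprD addrACA. Qed.

Lemma bracketZl c A C : bracket (c *: A) C = c *: bracket A C.
Proof. by rewrite /bracket -scalemxAl -scalemxAr -scalerBr. Qed.

Lemma bracketC A B : bracket A B = - bracket B A.
Proof. by rewrite /bracket opprB. Qed.

Lemma bracketDr A B C : bracket C (A + B) = bracket C A + bracket C B.
Proof. by rewrite bracketC bracketDl opprD -!bracketC. Qed.

Lemma bracketZr c A C : bracket C (c *: A) = c *: bracket C A.
Proof. by rewrite bracketC bracketZl -scalerN -bracketC. Qed.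

Lemma bracketNl A C : bracket (- A) C = - bracket A C.
Proof. by rewrite -scaleN1r bracketZl scaleN1r. Qed.

Lemma bracketAA A : bracket A A = 0. Proof. exact: subrr. Qed.

Lemma bracket_jacobi A B C : bracket A (bracket B C) =
    bracket (bracket A B) C + bracket B (bracket A C).
Proof.
rewrite /bracket !mulmxBr !mulmxBl !mulmxA.
by apply/matrixP => i j; rewrite !(addmxE, oppmxE); ring.
Qed.

Lemma ip_bracket A B C : ip (bracket A B) C = - ip B (bracket A C).
Proof.
rewrite /ip /bracket mulmxBl mulmxBr !raddfB /= -!mulmxA (mxtrace_mulC A) -!mulmxA.
ring.
Qed.

Lemma ip_Qmx k l : (0 < k < 11)%N -> (0 < l < 11)%N ->
  ip (Qmx R k) (Qmx R l) = (k == l)%:R.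
Proof.
move=> hk hl; rewrite !Qmx_spmx // ip_Qcoef (bigD1_seq k) ?iota_uniq ?mem_index_iota //=.
rewrite /kron eqxx mul1r eq_sym big1 ?addr0 // => m mk.
by rewrite eq_sym (negbTE mk) mul0r.
Qed.

Lemma sp_add A B : sp A -> sp B -> sp (A + B).
Proof.
move=> [a1 a2] [b1 b2]; split.
  by rewrite map_mxD [_^T]linearD /= addrACA a1 b1 addr0.
move: (symplJ R) a2 b2 => J a2 b2.
by rewrite [_^T]linearD /= mulmxDl mulmxDr addrACA a2 b2 addr0.
Qed.

Lemma sp_scale (r : R) A : sp A -> sp (r%:C *: A).
Proof.
move=> [a1 a2]; split.
  have -> : map_mx (@conjc R) (r%:C *: A) = r%:C *: map_mx (@conjc R) A.
    apply/matrixP => i j; rewrite !mxE; case: (A i j) => u v.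
    by apply/eqP; rewrite eq_complex /=; apply/andP; split; apply/eqP; ring.
  by rewrite [_^T]linearZ /= -scalerDr a1 scaler0.
move: (symplJ R) a2 => J a2.
by rewrite [_^T]linearZ /= -scalemxAl -scalemxAr -scalerDr a2 scaler0.
Qed.

Lemma sp_bracket A B : sp A -> sp B -> sp (bracket A B).
Proof.
move=> [/eqP + /eqP +] [/eqP + /eqP]; rewrite !addr_eq0.
move=> /eqP a1 /eqP a2 /eqP b1 /eqP b2.
split; apply/eqP; rewrite addr_eq0 /bracket.
  rewrite map_mxB !map_mxM [_^T]linearB /= !trmx_mul a1 b1.
  by rewrite !mulNmx !mulmxN !opprK opprB.
move: (symplJ R) a2 b2 => J a2 b2.
rewrite [_^T]linearB /= !trmx_mul mulmxBl mulmxBr -!mulmxA a2 b2 !mulmxN !mulmxA a2 b2.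
by rewrite !mulNmx !opprK opprB -!mulmxA.
Qed.

Lemma sp_Qmx k : (0 < k < 11)%N -> sp (Qmx R k).
Proof.
move=> hk; rewrite Qmx_spmx //; move: (Qcoef _) => x; split.
  have -> : (map_mx (@conjc R) (spmx x))^T = mx4 (fun i j => conjc (spfun x j i)).
    by apply/matrixP => i j; rewrite !mxE.
  rewrite /spmx mx4_add; apply/matrixP => i j; rewrite !mxE.
  move: i j => [[|[|[|[|//]]]] hi] [[|[|[|[|//]]]] hj]; apply/eqP; rewrite eq_complex /=;
    apply/andP; split; apply/eqP; ring.
have -> : (spmx x)^T = mx4 (fun i j => spfun x j i).
  by apply/matrixP => i j; rewrite !mxE.
rewrite /symplJ !Emx4 // !(mx4_sub, mx4_add) /spmx !mx4_mul mx4_add.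
apply/matrixP => i j; rewrite !mxE.
move: i j => [[|[|[|[|//]]]] hi] [[|[|[|[|//]]]] hj]; apply/eqP; rewrite eq_complex /=;
    apply/andP; split; apply/eqP; ring.
Qed.

Lemma sp_sum (I : Type) (r : seq I) (F : I -> C4) :
  (forall i, sp (F i)) -> sp (\sum_(i <- r) F i).
Proof.
move=> hF; elim: r => [|i r IH]; last by rewrite big_cons; exact: sp_add.
rewrite big_nil; split; last by rewrite trmx0 mul0mx mulmx0 addr0.
by rewrite map_mx0 trmx0 addr0.
Qed.

Definition mvec (x : 'rV[R]_7) : C4 := \sum_(k < 7) (x 0 k)%:C *: Qmx R k.+1.

Definition mcoord A : 'rV[R]_7 := \row_k ip A (Qmx R k.+1).

(** The matrix, acting on rows, of the compression to m of ad(A). *)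
Definition ad_m A : 'M[R]_7 := \matrix_(i, j) ip (bracket A (Qmx R i.+1)) (Qmx R j.+1).

Let ord7 (k : 'I_7) : (0 < k.+1 < 11)%N.
Proof. by rewrite /= ltnS (leq_trans (ltn_ord k)). Qed.

Lemma mcoordD A B : mcoord (A + B) = mcoord A + mcoord B.
Proof. by apply/rowP => k; rewrite !mxE ipDl. Qed.

Lemma mcoordZ (r : R) A : mcoord (r%:C *: A) = r *: mcoord A.
Proof. by apply/rowP => k; rewrite !mxE ipZl. Qed.

Lemma mcoordN A : mcoord (- A) = - mcoord A.
Proof. by apply/rowP => k; rewrite !mxE ipNl. Qed.

Lemma mvecD x y : mvec (x + y) = mvec x + mvec y.
Proof.
by rewrite /mvec -big_split; apply: eq_bigr => k _; rewrite mxE rmorphD scalerDl.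
Qed.

Lemma mvecZ (r : R) x : mvec (r *: x) = r%:C *: mvec x.
Proof.
by rewrite /mvec scaler_sumr; apply: eq_bigr => k _; rewrite mxE rmorphM scalerA.
Qed.

Lemma mvecN x : mvec (- x) = - mvec x.
Proof. by rewrite -scaleN1r mvecZ rmorphN1 scaleN1r. Qed.

Lemma ad_mD A B : ad_m (A + B) = ad_m A + ad_m B.
Proof. by apply/matrixP => i j; rewrite !mxE bracketDl ipDl. Qed.

Lemma ad_mZ (r : R) A : ad_m (r%:C *: A) = r *: ad_m A.
Proof. by apply/matrixP => i j; rewrite !mxE bracketZl ipZl. Qed.

Lemma ad_mN A : ad_m (- A) = - ad_m A.
Proof. by apply/matrixP => i j; rewrite !mxE bracketNl ipNl. Qed.

Lemma ad_m_skew A : (ad_m A)^T = - ad_m A.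
Proof. by apply/matrixP => i j; rewrite !mxE ip_bracket ipC. Qed.

Lemma mul_ad_m x A : x *m ad_m A = mcoord (bracket A (mvec x)).
Proof.
apply/rowP => k; rewrite !mxE ip_bracket /mvec ip_suml -sumrN.
by apply: eq_bigr => i _; rewrite ipZl mxE ip_bracket mulrN.
Qed.

Lemma mvecK x : mcoord (mvec x) = x.
Proof.
apply/rowP => k; rewrite mxE /mvec ip_suml (bigD1 k) //= ipZl ip_Qmx // eqxx mulr1.
rewrite big1 ?addr0 // => i ik; rewrite ipZl ip_Qmx // eqSS.
by rewrite (inj_eq val_inj) (negbTE ik) mulr0.
Qed.

Lemma sp_mvec x : sp (mvec x).
Proof. by apply: sp_sum => k; apply/sp_scale/sp_Qmx. Qed.

Local Notation hh := (@lie_h R).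

Lemma proj_mE A : proj_m A = mvec (mcoord A).
Proof.
rewrite /proj_m sum_1_8 /mvec; apply: eq_bigr => k _.
rewrite [mcoord A 0 k]mxE; reflexivity.
Qed.

Lemma mcoord_h W : hh W -> mcoord W = 0.
Proof.
move=> [a [b [c ->]]]; apply/rowP => k; rewrite [LHS]mxE [RHS]mxE.
have Q0 j : (7 < j < 11)%N -> ip (Qmx R j) (Qmx R k.+1) = 0.
  move=> /andP[j7 j11]; rewrite ip_Qmx //; last by rewrite (leq_ltn_trans _ j7).
  by rewrite gtn_eqF // (leq_ltn_trans (ltn_ord k) j7).
exact: (ip_comb3_eq0 a b c (Q0 8%N isT) (Q0 9%N isT) (Q0 10%N isT)).
Qed.

Lemma sp_h W : hh W -> sp W.
Proof.
have s (r : R) k (hk : (0 < k < 11)%N) := sp_scale r (sp_Qmx hk).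
move=> [a [b [c ->]]].
exact: (sp_add (sp_add (s a 8%N isT) (s b 9%N isT)) (s c 10%N isT)).
Qed.

Lemma comb3_eq0 (a b c : R) A B C : a = 0 -> b = 0 -> c = 0 ->
  a%:C *: A + b%:C *: B + c%:C *: C = 0.
Proof. by move=> -> -> ->; rewrite !scale0r !addr0. Qed.

Lemma comb3_unit A B C :
  [/\ A = (1 : R)%:C *: A + (0 : R)%:C *: B + (0 : R)%:C *: C,
      B = (0 : R)%:C *: A + (1 : R)%:C *: B + (0 : R)%:C *: C &
      C = (0 : R)%:C *: A + (0 : R)%:C *: B + (1 : R)%:C *: C].
Proof. by split; rewrite scale1r !scale0r ?add0r ?addr0. Qed.

Lemma h_Qmx : [/\ hh (Qmx R 8), hh (Qmx R 9) & hh (Qmx R 10)].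
Proof.
have [e8 e9 e10] := comb3_unit (Qmx R 8) (Qmx R 9) (Qmx R 10).
split; [exists 1, 0, 0; exact: e8|exists 0, 1, 0; exact: e9|exists 0, 0, 1; exact: e10].
Qed.

Lemma sub_mcoordK A : sp A -> A - mvec (mcoord A) =
  (ip A (Qmx R 8))%:C *: Qmx R 8 + (ip A (Qmx R 9))%:C *: Qmx R 9
  + (ip A (Qmx R 10))%:C *: Qmx R 10.
Proof. by move=> /sp_expand A_sum; rewrite -proj_mE {1}A_sum; exact: sum_8_11. Qed.

Lemma sp_split A : sp A -> hh (A - mvec (mcoord A)).
Proof.
move=> /sub_mcoordK ->.
exists (ip A (Qmx R 8)), (ip A (Qmx R 9)), (ip A (Qmx R 10)); reflexivity.
Qed.

Lemma mcoordK A : sp A -> (forall W, hh W -> ip A W = 0) -> mvec (mcoord A) = A.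
Proof.
move=> spA A_orth; have [h8 h9 h10] := h_Qmx.
apply/esym/subr0_eq/(etrans (sub_mcoordK spA)); apply: comb3_eq0; exact: A_orth.
Qed.

Definition hcoef (a b c : R) (k : nat) : R :=
  if k == 8%N then a else if k == 9%N then b else if k == 10%N then c else 0.

Lemma sum_hcoef (F : nat -> C4) (a b c : R) :
  \sum_(1 <= k < 11) (hcoef a b c k)%:C *: F k =
  a%:C *: F 8%N + b%:C *: F 9%N + c%:C *: F 10%N.
Proof. by rewrite sum10 /hcoef /= !scale0r !add0r. Qed.

Lemma h_spmx W : hh W -> exists a b c, W = spmx (Qcoef (hcoef a b c)).
Proof.
move=> [a [b [c ->]]]; exists a, b, c.
exact: etrans (esym (sum_hcoef _ a b c)) (Qsum _).
Qed.

Lemma spmx_h (a b c : R) : hh (spmx (Qcoef (hcoef a b c))).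
Proof. exists a, b, c; exact: etrans (esym (Qsum _)) (sum_hcoef _ a b c). Qed.

(** On Q_8, Q_9, Q_10 the bracket is the vector product of R^3. *)
Lemma bracket_h W W' : hh W -> hh W' -> hh (bracket W W').
Proof.
move=> /h_spmx[a8 [a9 [a10 ->]]] /h_spmx[b8 [b9 [b10 ->]]].
have -> : bracket (spmx (Qcoef (hcoef a8 a9 a10))) (spmx (Qcoef (hcoef b8 b9 b10))) =
    spmx (Qcoef (hcoef (a9 * b10 - a10 * b9) (a10 * b8 - a8 * b10) (a8 * b9 - a9 * b8))).
  rewrite bracket_spmx.
  have [s5 [s3 [s2 [r52 [r6 r5 r3 r2] [h5 h3 h2]]]]] := sqrt_relations R.
  apply: mx4_ext => i j hi hj; rewrite /spfun /Qcoef /spmx_bracket_coef /hcoef /= r52 r6 r5 r3 r2.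
  move: i j hi hj => [|[|[|[|//]]]] [|[|[|[|//]]]] _ _; apply/eqP; rewrite eq_complex /=;
    apply/andP; split; apply/eqP; by field: h5 h3 h2.
exact: spmx_h.
Qed.

End IsotropySplitting.

(** * The m-part of the bracket is a vector cross product *)

Section CrossProduct.
Local Open Scope complex_scope.
Variable R : realType.
Local Notation C4 := 'M[R[i]]_4.

(** The octonionic cross product: each of the seven lines of a Fano plane
    contributes one structure constant, up to antisymmetry. *)
Definition cross_coef (x y : nat -> R) (k : nat) : R :=
  match k with
  | 1%N => (x 2%N * y 3%N - x 3%N * y 2%N) + - (x 4%N * y 5%N - x 5%N * y 4%N) +
      - (x 6%N * y 7%N - x 7%N * y 6%N)
  | 2%N => - (x 1%N * y 3%N - x 3%N * y 1%N) + (x 4%N * y 6%N - x 6%N * y 4%N) +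
      - (x 5%N * y 7%N - x 7%N * y 5%N)
  | 3%N => (x 1%N * y 2%N - x 2%N * y 1%N) + (x 4%N * y 7%N - x 7%N * y 4%N) + (x 5%N * y 6%N
      - x 6%N * y 5%N)
  | 4%N => (x 1%N * y 5%N - x 5%N * y 1%N) + - (x 2%N * y 6%N - x 6%N * y 2%N) +
      - (x 3%N * y 7%N - x 7%N * y 3%N)
  | 5%N => - (x 1%N * y 4%N - x 4%N * y 1%N) + (x 2%N * y 7%N - x 7%N * y 2%N) +
      - (x 3%N * y 6%N - x 6%N * y 3%N)
  | 6%N => (x 1%N * y 7%N - x 7%N * y 1%N) + (x 2%N * y 4%N - x 4%N * y 2%N) + (x 3%N * y 5%N
      - x 5%N * y 3%N)
  | 7%N => - (x 1%N * y 6%N - x 6%N * y 1%N) + - (x 2%N * y 5%N - x 5%N * y 2%N)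
      + (x 3%N * y 4%N - x 4%N * y 3%N)
  | _ => 0
  end.

(** Indices start at 1, as for the Q_k, and the coordinates along h vanish. *)
Definition coef_m (x : 'rV[R]_7) (k : nat) : R :=
  if (0 < k < 8)%N then x 0 (inord k.-1) else 0.

Lemma coef_m_ord x (k : 'I_7) : coef_m x k.+1 = x 0 k.
Proof. by rewrite /coef_m /= ltnS ltn_ord inord_val. Qed.

Lemma sum_coef_m (F : nat -> C4) x : \sum_(1 <= k < 11) (coef_m x k)%:C *: F k =
  \sum_(k < 7) (x 0 k)%:C *: F k.+1.
Proof.
rewrite (@big_cat_nat _ _ _ 8) //= [X in _ + X]big_nat_cond [X in _ + X]big1 ?addr0.
  by rewrite sum_1_8; apply: eq_bigr => k _; rewrite coef_m_ord.
by move=> k /andP[/andP[k8 _] _]; rewrite /coef_m [(k < 8)%N]ltnNge k8 andbF scale0r.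
Qed.

Lemma mvec_spmx x : mvec x = spmx (Qcoef (coef_m x)).
Proof. exact: etrans (esym (sum_coef_m _ x)) (Qsum _). Qed.

Lemma mcoord_bracket x y k : (0 < k < 8)%N ->
  coef_m (mcoord (bracket (mvec x) (mvec y))) k = cross_coef (coef_m x) (coef_m y) k.
Proof.
move=> hk; rewrite {1}/coef_m hk mxE inordK; last by case: k hk.
rewrite prednK; last by case/andP: hk.
rewrite !mvec_spmx bracket_spmx Qmx_spmx; last by case/andP: hk => -> /ltn_trans ->.
rewrite ip_spmx.
have [s5 [s3 [s2 [r52 [r6 r5 r3 r2] [h5 h3 h2]]]]] := sqrt_relations R.
have e0 z l : (7 < l)%N -> coef_m z l = 0 by move=> l7;
    rewrite /coef_m [(l < 8)%N]ltnNge l7 andbF.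
have := (e0 x 8%N isT, e0 x 9%N isT, e0 x 10%N isT).
have := (e0 y 8%N isT, e0 y 9%N isT, e0 y 10%N isT).
move: (coef_m x) (coef_m y) => {}x {}y [[y8 y9] y10] [[x8 x9] x10].
case: k hk => [//|[|[|[|[|[|[|[|//]]]]]]]] _;
    rewrite /Qcoef /kron /spmx_bracket_coef /= r52 r6 r5 r3 r2 x8 x9 x10 y8 y9 y10;
 by field: h5 h3 h2.
Qed.

Lemma dot_coef_m x y : dot x y = coef_m x 1%N * coef_m y 1%N + coef_m x 2%N * coef_m y 2%N
    + coef_m x 3%N * coef_m y 3%N +
  coef_m x 4%N * coef_m y 4%N + coef_m x 5%N * coef_m y 5%N + coef_m x 6%N * coef_m y 6%N
      + coef_m x 7%N * coef_m y 7%N.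
Proof.
rewrite /dot mxE; under eq_bigr => k _ do rewrite mxE.
have <- : \sum_(1 <= k < 8) coef_m x k * coef_m y k = \sum_(k < 7) x 0 k * y 0 k.
  by rewrite sum_1_8; apply: eq_bigr => k _; rewrite !coef_m_ord.
by rewrite /index_iota /= !big_cons big_nil addr0 !addrA.
Qed.

(** The identity of vector cross products that makes the theorem true for V_1: here
    it is a polynomial identity in fourteen variables. *)
Lemma cross_cross (x y : 'rV[R]_7) :
  mcoord (bracket (mvec x) (mvec (mcoord (bracket (mvec x) (mvec y))))) =
      dot x y *: x - dot x x *: y.
Proof.
have row_ext (u v : 'rV[R]_7) : (forall k, (0 < k < 8)%N -> coef_m u k = coef_m v k) -> u = v.
  move=> uv; apply/rowP => k; have := uv k.+1.
  by rewrite !coef_m_ord; apply; rewrite /= ltnS ltn_ord.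
apply: row_ext => k hk.
have -> : coef_m (dot x y *: x - dot x x *: y) k = dot x y * coef_m x k - dot x x * coef_m y k.
  by rewrite /coef_m hk !mxE.
rewrite mcoord_bracket // !dot_coef_m.
have cE l (hl : (0 < l < 8)%N) := mcoord_bracket x y hl.
case: k hk => [//|[|[|[|[|[|[|[|//]]]]]]]] _; rewrite /= !cE //=; ring.
Qed.

End CrossProduct.

(** * Connection and curvature on m *)

#[local] Opaque bracket ip.

(** The next identities are the algebra of [curv] and [conn] with their building
    blocks as indeterminates: a, b stand for [half_ad], M or m for [half_ad] of a
    bracket, N for [ad_m] of it. *)
Lemma commutator_linear (R : realType) n (r : R) (M M' N N' a a' y : 'M[R]_n) :
  r *: M + M' - (r *: N + N') + (y *m (r *: a + a') - (r *: a + a') *m y) =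
  r *: (M - N + (y *m a - a *m y)) + (M' - N' + (y *m a' - a' *m y)).
Proof.
rewrite mulmxDl mulmxDr -scalemxAl -scalemxAr.
move: (y *m a) (a *m y) (y *m a') (a' *m y) => p1 p2 p3 p4.
by apply/matrixP => i j; rewrite !(addmxE, oppmxE, scalemxE); ring.
Qed.

Lemma skew_bracket (R : realType) n (M N a b : 'M[R]_n) :
  M^T = - M -> N^T = - N -> a^T = - a -> b^T = - b ->
  (M - N + (b *m a - a *m b))^T = - (M - N + (b *m a - a *m b)).
Proof.
move=> sM sN sa sb; rewrite !linearD !linearN /= !trmx_mul sM sN sa sb !mulNmx !mulmxN !opprK.
move: (b *m a) (a *m b) => p q.
by apply/matrixP => i j; rewrite !(addmxE, oppmxE); ring.
Qed.

(** The map y |-> 1/2 [x,y]_m, by which the Levi-Civita connection differs from the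
    canonical one. *)
Definition half_ad (R : realType) (x : 'rV[R]_7) : 'M[R]_7 := 2^-1 *: ad_m (mvec x).

Lemma invariant_bracket (R : realType) n (A M M1 M2 N N1 N2 a b : 'M[R]_n) :
  M *m A = A *m M + (M1 + M2) -> N *m A = A *m N + (N1 + N2) ->
  (M - N + (b *m a - a *m b)) *m A =
  A *m (M - N + (b *m a - a *m b))
  + (M1 - N1 + (b *m (a *m A - A *m a) - (a *m A - A *m a) *m b))
  + (M2 - N2 + ((b *m A - A *m b) *m a - a *m (b *m A - A *m b))).
Proof.
move=> MA NA.
rewrite !(mulmxDl, mulmxDr, mulmxN, mulNmx) MA NA !mulmxA.
move: (A *m M) (A *m N) (b *m a *m A) (a *m b *m A) (A *m b *m a) (A *m a *m b).
move: (b *m A *m a) (a *m A *m b) => p1 p2 p3 p4 p5 p6 p7 p8.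
by apply/matrixP => i j; rewrite !(addmxE, oppmxE); ring.
Qed.

(** Here V and W stand for [ad_m] of elements of h. *)
Lemma curvature_bracket (R : realType) n (m p q N k V W a b : 'M[R]_n) :
  b *m W = W *m b + q -> a *m V = V *m a + p -> V *m W = W *m V + k ->
  - (N - 2 *: p + 2 *: q + k - (m - p + q)) + (V + b) *m (W + a) - (W + a) *m (V + b) =
  m - N + (b *m a - a *m b).
Proof.
move=> bW aV VW; rewrite !(mulmxDl, mulmxDr) bW aV VW.
move: (W *m b) (V *m a) (W *m V) (b *m a) (a *m b) => p1 p2 p3 p4 p5.
by apply/matrixP => i j; rewrite !(addmxE, oppmxE, scalemxE); ring.
Qed.

Lemma half_difference (R : realType) n (p q m : 'rV[R]_n) :
  q + 2^-1 *: m - (p + 2^-1 *: - m) = m - p + q.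
Proof. by apply/rowP => j; rewrite !(addmxE, oppmxE, scalemxE); field. Qed.

Section BracketAlgebra.
Local Open Scope complex_scope.
Variable R : realType.
Local Notation C4 := 'M[R[i]]_4.
Implicit Types (A B L V W X Y : C4) (x y a b : 'rV[R]_7).
Local Notation hh := (@lie_h R).

Lemma ip_h_mvec W x : hh W -> ip W (mvec x) = 0.
Proof.
move=> /mcoord_h W0; rewrite ipC /mvec ip_suml big1 // => k _.
have := congr1 (fun v : 'rV_7 => v 0 k) W0; rewrite [mcoord W 0 k]mxE [_ 0 k]mxE => Wk.
by rewrite ipZl ipC Wk mulr0.
Qed.

(** [h,m] lies in m: for V in h, invariance turns <[W,X],V> into - <X,[W,V]>, and
    [W,V] lies in h. *)
Lemma mcoordK_bracket_h W x : hh W -> mvec (mcoord (bracket W (mvec x))) = bracket W (mvec x).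
Proof.
move=> hW; apply: mcoordK; first exact: sp_bracket (sp_h hW) (sp_mvec x).
by move=> V hV; rewrite ip_bracket ipC ip_h_mvec ?oppr0 //; exact: bracket_h.
Qed.

(** The h-part of A contributes to [W,A] only inside h. *)
Lemma mcoord_bracket_h W A : hh W -> sp A -> mcoord (bracket W (mvec (mcoord A))) =
    mcoord (bracket W A).
Proof.
move=> hW /sp_split hA; rewrite -[A in RHS](subrK (mvec (mcoord A))) bracketDr mcoordD.
by rewrite (mcoord_h (bracket_h hW hA)) add0r.
Qed.

Lemma row_mulP n (M N : 'M[R]_n) : (forall x : 'rV_n, x *m M = x *m N) -> M = N.
Proof. by move=> MN; apply/row_matrixP => i; rewrite !rowE MN. Qed.

(** For W in h, compressing to m before applying ad(W) loses nothing, so the Jacobi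
    identity passes to the compressions. *)
Lemma ad_m_comm W B : hh W -> sp B ->
  ad_m B *m ad_m W = ad_m W *m ad_m B + ad_m (bracket W B).
Proof.
move=> hW sB; apply: row_mulP => x.
have NN (C D : C4) : x *m (ad_m C *m ad_m D) =
    mcoord (bracket D (mvec (mcoord (bracket C (mvec x))))).
  by rewrite mulmxA !mul_ad_m.
rewrite mulmxDr !NN mul_ad_m (mcoordK_bracket_h _ hW) (mcoord_bracket_h hW (sp_bracket sB
    (sp_mvec x))).
rewrite (bracket_jacobi W) mcoordD addrC; reflexivity.
Qed.

(** The curvature R(x,y) at the origin of the normal homogeneous metric,
    z |-> 1/2 [[x,y]_m,z]_m - [[x,y],z]_m + 1/4 [x,[y,z]_m]_m - 1/4 [y,[x,z]_m]_m. *)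
Definition curv x y : 'M[R]_7 :=
  half_ad (mcoord (bracket (mvec x) (mvec y))) - ad_m (bracket (mvec x) (mvec y))
  + (half_ad y *m half_ad x - half_ad x *m half_ad y).

Lemma half_ad_linear : linear (@half_ad R).
Proof.
by move=> r x y; rewrite /half_ad mvecD mvecZ ad_mD ad_mZ scalerDr !scalerA mulrC.
Qed.

Lemma half_adD x y : half_ad (x + y) = half_ad x + half_ad y.
Proof. by have := half_ad_linear 1 x y; rewrite !scale1r. Qed.

Lemma mcoord0 : mcoord 0 = 0 :> 'rV[R]_7.
Proof. by apply/rowP => k; rewrite !mxE ip0l. Qed.

Lemma half_ad_alt x : x *m half_ad x = 0.
Proof. by rewrite /half_ad -scalemxAr mul_ad_m bracketAA mcoord0 scaler0. Qed.

Lemma half_ad_cross x a :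
  a *m half_ad x *m half_ad x = 4^-1 *: (dot a x *: x - dot x x *: a).
Proof.
rewrite /half_ad -!scalemxAr -scalemxAl scalerA !mul_ad_m cross_cross (dotC a).
by congr (_ *: _); field.
Qed.

Lemma half_ad_skew x : (half_ad x)^T = - half_ad x.
Proof. by rewrite /half_ad [_^T]linearZ /= ad_m_skew scalerN. Qed.

Lemma half_ad_invariant W x : hh W ->
  half_ad x *m ad_m W = ad_m W *m half_ad x + half_ad (x *m ad_m W).
Proof.
move=> hW; rewrite /half_ad -scalemxAl -scalemxAr mul_ad_m (mcoordK_bracket_h _ hW).
by rewrite (ad_m_comm hW (sp_mvec x)) scalerDr.
Qed.

Lemma curv_linl y : linear (curv ^~ y).
Proof.
move=> r x x'.
have l : bracket (mvec (r *: x + x')) (mvec y) =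
    r%:C *: bracket (mvec x) (mvec y) + bracket (mvec x') (mvec y).
  by rewrite mvecD mvecZ bracketDl bracketZl.
rewrite /curv l mcoordD mcoordZ ad_mD ad_mZ (half_ad_linear r x x') (half_ad_linear r (mcoord _)
    (mcoord _)).
apply commutator_linear.
Qed.

Lemma half_ad0 : half_ad (0 : 'rV[R]_7) = 0.
Proof. by apply: (addrI (half_ad 0)); rewrite -half_adD !addr0. Qed.

Lemma half_adN x : half_ad (- x) = - half_ad x.
Proof. by apply: (addIr (half_ad x)); rewrite -half_adD !addNr half_ad0. Qed.

Lemma curv_antisym x y : curv x y = - curv y x.
Proof.
rewrite /curv (bracketC (mvec x)) mcoordN half_adN ad_mN.
have swap (M N p q : 'M[R]_7) : - M - - N + (q - p) = - (M - N + (p - q)).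
  by apply/matrixP => i j; rewrite !(addmxE, oppmxE); ring.
exact (swap _ _ _ _).
Qed.

Lemma curv_alt x : curv x x = 0.
Proof.
have N0 : ad_m (0 : C4) = 0 by have := ad_mZ 0 (0 : C4); rewrite scaler0 scale0r.
have A0 : half_ad (mcoord (0 : C4)) = 0 by rewrite mcoord0 half_ad0.
have -> : curv x x = half_ad (mcoord (0 : C4)) - ad_m (0 :
    C4) + (half_ad x *m half_ad x - half_ad x *m half_ad x).
  by rewrite /curv bracketAA.
rewrite A0 N0 !subrr addr0; reflexivity.
Qed.

Lemma curv_linr x : linear (curv x).
Proof.
move=> r y y'; have a u := curv_antisym x u.
have E : curv (r *: y + y') x = r *: curv y x + curv y' x := curv_linl x r y y'.
rewrite (a (r *: y + y')) E (a y) (a y') opprD scalerN; reflexivity.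
Qed.

Lemma curv_skew x y : (curv x y)^T = - curv x y.
Proof.
have := (half_ad_skew x, half_ad_skew y, half_ad_skew (mcoord (bracket (mvec x) (mvec y)))).
have := ad_m_skew (bracket (mvec x) (mvec y)).
rewrite /curv; move=> sN [[sx sy] sxy]; exact: skew_bracket.
Qed.

(** Brackets and the projection to m are equivariant under h. *)
Lemma curv_invariant W x y : hh W ->
  curv x y *m ad_m W =
  ad_m W *m curv x y + curv (x *m ad_m W) y + curv x (y *m ad_m W).
Proof.
move=> hW; set A := ad_m W.
have mvecA z : mvec (z *m A) = bracket W (mvec z) by rewrite mul_ad_m mcoordK_bracket_h.
have inv z : half_ad z *m A = A *m half_ad z + half_ad (z *m A) by exact: half_ad_invariant.
have adA : forall z, half_ad (z *m A) = half_ad z *m A - A *m half_ad z.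
  by move=> z; rewrite inv addrC addKr.
have sL : sp (bracket (mvec x) (mvec y)) := sp_bracket (sp_mvec x) (sp_mvec y).
have adL : half_ad (mcoord (bracket (mvec x) (mvec y)) *m A) =
    half_ad (mcoord (bracket (bracket W (mvec x)) (mvec y)))
        + half_ad (mcoord (bracket (mvec x) (bracket W (mvec y)))).
  by rewrite mul_ad_m (mcoord_bracket_h hW sL) bracket_jacobi mcoordD half_adD.
have NL : ad_m (bracket (mvec x) (mvec y)) *m A = A *m ad_m (bracket (mvec x) (mvec y)) +
    (ad_m (bracket (bracket W (mvec x)) (mvec y)) + ad_m (bracket (mvec x) (bracket W (mvec y)))).
  apply: etrans (ad_m_comm hW sL) _.
  rewrite (bracket_jacobi W) ad_mD; reflexivity.
rewrite /curv (mvecA x) (mvecA y) (adA x) (adA y).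
apply invariant_bracket; [rewrite inv adL; reflexivity|exact NL].
Qed.

(** The connection form as a function of the value of the Maurer-Cartan form: ad of
    its h-part plus half of ad of its m-part. *)
Definition conn A : 'M[R]_7 := ad_m (A - mvec (mcoord A)) + half_ad (mcoord A).

Lemma connD A B : conn (A + B) = conn A + conn B.
Proof.
have e : A + B - (mvec (mcoord A) + mvec (mcoord B)) =
    (A - mvec (mcoord A)) + (B - mvec (mcoord B)).
  by rewrite opprD addrACA.
rewrite /conn mcoordD mvecD half_adD e ad_mD; exact: addrACA.
Qed.

Lemma connZ (r : R) A : conn (r%:C *: A) = r *: conn A.
Proof.
have e : half_ad (r *: mcoord A) = r *: half_ad (mcoord A).
  by have := half_ad_linear r (mcoord A) 0; rewrite half_ad0 !addr0.
rewrite /conn mcoordZ mvecZ -scalerBr ad_mZ e scalerDr; reflexivity.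
Qed.

Lemma connN A : conn (- A) = - conn A.
Proof.
have e : - A - - mvec (mcoord A) = - (A - mvec (mcoord A)) by rewrite opprD.
rewrite /conn mcoordN mvecN half_adN e ad_mN opprD; reflexivity.
Qed.

Lemma conn_skew A : (conn A)^T = - conn A.
Proof.
have skewD (M N : 'M[R]_7) : M^T = - M -> N^T = - N -> (M + N)^T = - (M + N).
  by move=> sM sN; rewrite linearD /= sM sN opprD.
exact: skewD (ad_m_skew _) (half_ad_skew _).
Qed.

Lemma half_ad_double x : ad_m (mvec x) = 2 *: half_ad x.
Proof. by rewrite /half_ad scalerA divff ?scale1r. Qed.

Lemma connE A : conn A = ad_m A - half_ad (mcoord A).
Proof.
rewrite /conn ad_mD ad_mN half_ad_double; move: (ad_m A) (half_ad _) => M N.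
by apply/matrixP => i j; rewrite !(addmxE, oppmxE, scalemxE); ring.
Qed.

Lemma bracket_addadd W X V Y :
  bracket (W + X) (V + Y) = bracket X Y - bracket V X + bracket W Y + bracket W V.
Proof.
rewrite bracketDl (bracketDr V) (bracketDr V) (bracketC X V).
move: (bracket W V) (bracket W Y) (bracket V X) (bracket X Y) => p q r s.
by apply/matrixP => i j; rewrite !(addmxE, oppmxE); ring.
Qed.

Lemma bracket_split A B : sp A -> sp B ->
  let X := mvec (mcoord A) in let Y := mvec (mcoord B) in let W := A - X in let V := B - Y in
  bracket A B = bracket X Y - bracket V X + bracket W Y + bracket W V.
Proof.
move=> sA sB X Y W V.
have eA : A = W + X by rewrite subrK.
have eB : B = V + Y by rewrite subrK.
exact: etrans (congr2 (@bracket R) eA eB) (bracket_addadd W X V Y).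
Qed.

Lemma mcoord_bracket_split A B : sp A -> sp B ->
  let X := mvec (mcoord A) in let Y := mvec (mcoord B) in let W := A - X in let V := B - Y in
  mcoord (bracket A B) = mcoord (bracket X Y) - mcoord (bracket V X) + mcoord (bracket W Y).
Proof.
move=> sA sB X Y W V.
have h0 : mcoord (bracket W V) = 0 := mcoord_h (bracket_h (sp_split sA) (sp_split sB)).
have co4 (p q r s : C4) : mcoord (p - q + r + s) = mcoord p - mcoord q + mcoord r + mcoord s.
  by rewrite !mcoordD mcoordN.
apply: etrans (congr1 (@mcoord R) (bracket_split sA sB)) _; apply: etrans (co4 _ _ _ _) _.
exact: etrans (congr1 (fun z => _ + z) h0) (addr0 _).
Qed.

(** Decompose both arguments along h and m; the term [h,h] has no m-part, and the
    two halves of [m,m] add up. *)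
Lemma conn_torsion A B : sp A -> sp B ->
  mcoord B *m conn A - mcoord A *m conn B = mcoord (bracket A B).
Proof.
move=> sA sB; apply: etrans _ (esym (mcoord_bracket_split sA sB)).
have e (x : 'rV[R]_7) (W Y : C4) : x *m (ad_m W + half_ad (mcoord Y)) =
    mcoord (bracket W (mvec x)) + 2^-1 *: mcoord (bracket (mvec (mcoord Y)) (mvec x)).
  by rewrite mulmxDr /half_ad -scalemxAr !mul_ad_m.
have e2 : mcoord (bracket (mvec (mcoord B)) (mvec (mcoord A))) =
    - mcoord (bracket (mvec (mcoord A)) (mvec (mcoord B))).
  by rewrite bracketC mcoordN.
have eB := etrans (e (mcoord A) (B - mvec (mcoord B)) B) (congr1 (fun z => _ + 2^-1 *: z) e2).
exact (etrans (congr2 (fun u v => u - v) (e (mcoord B) (A - mvec (mcoord A)) A) eB)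
              (half_difference _ _ _)).
Qed.

(** The h-parts W and V, which depend on the choice of the lift, drop out. *)
Lemma curv_gauge x y W V L : hh W -> hh V ->
  L = bracket (mvec x) (mvec y) - bracket V (mvec x) + bracket W (mvec y) + bracket W V ->
  mcoord L = mcoord (bracket (mvec x) (mvec y)) - mcoord (bracket V (mvec x))
      + mcoord (bracket W (mvec y)) ->
  - (ad_m L - half_ad (mcoord L)) + (ad_m V + half_ad y) *m (ad_m W + half_ad x)
  - (ad_m W + half_ad x) *m (ad_m V + half_ad y) = curv x y.
Proof.
move=> hW hV LE coLE.
have N2 Z z : hh Z -> ad_m (bracket Z (mvec z)) = 2 *: half_ad (mcoord (bracket Z (mvec z))).
  by move=> hZ; rewrite -half_ad_double mcoordK_bracket_h.
have N4 (p q r s : C4) : ad_m (p - q + r + s) = ad_m p - ad_m q + ad_m r + ad_m s.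
  by rewrite !ad_mD ad_mN.
have a3 (p q r : 'rV[R]_7) : half_ad (p - q + r) = half_ad p - half_ad q + half_ad r.
  by rewrite !half_adD half_adN.
have inv Z z : hh Z -> half_ad z *m ad_m Z =
    ad_m Z *m half_ad z + half_ad (mcoord (bracket Z (mvec z))).
  by move=> hZ; rewrite -mul_ad_m; exact: half_ad_invariant.
have NL := etrans (congr1 (@ad_m R) LE) (N4 _ _ _ _).
rewrite (N2 V x hV) (N2 W y hW) in NL.
have aL := etrans (congr1 (@half_ad R) coLE) (a3 _ _ _).
rewrite NL aL.
exact (curvature_bracket _ _ (inv W y hW) (inv V x hV) (ad_m_comm hW (sp_h hV))).
Qed.

(** By the Maurer-Cartan equation the first term is the exterior derivative of the
    connection form, so the left-hand side is its curvature. *)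
Lemma conn_curvature A B : sp A -> sp B ->
  - conn (bracket A B) + conn B *m conn A - conn A *m conn B = curv (mcoord A) (mcoord B).
Proof.
move=> sA sB; rewrite connE.
exact (curv_gauge (sp_split sA) (sp_split sB) (bracket_split sA sB) (mcoord_bracket_split sA sB)).
Qed.

End BracketAlgebra.

(** * Derivatives of complex matrices *)

Section ComplexMatrices.
Local Open Scope complex_scope.
Variable R : realType.

Lemma re_cplx m n (A B : 'M[R]_(m, n)) : re_mx (cplx_mx A B) = A.
Proof. by apply/matrixP => i j; rewrite !mxE. Qed.

Lemma im_cplx m n (A B : 'M[R]_(m, n)) : im_mx (cplx_mx A B) = B.
Proof. by apply/matrixP => i j; rewrite !mxE. Qed.

Lemma cplx_re_im m n (A : 'M[R[i]]_(m, n)) : cplx_mx (re_mx A) (im_mx A) = A.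
Proof. by apply/matrixP => i j; rewrite !mxE; case: (A i j). Qed.

Lemma re_mulmx m n p (A : 'M[R[i]]_(m, n)) (B : 'M[R[i]]_(n, p)) :
  re_mx (A *m B) = re_mx A *m re_mx B - im_mx A *m im_mx B.
Proof.
apply/matrixP => i j; rewrite !mxE raddf_sum -sumrB; apply: eq_bigr => k _.
by rewrite !mxE; case: (A i k) (B k j) => [? ?] [? ?].
Qed.

Lemma im_mulmx m n p (A : 'M[R[i]]_(m, n)) (B : 'M[R[i]]_(n, p)) :
  im_mx (A *m B) = re_mx A *m im_mx B + im_mx A *m re_mx B.
Proof.
apply/matrixP => i j; rewrite !mxE raddf_sum -big_split; apply: eq_bigr => k _.
by rewrite !mxE; case: (A i k) (B k j) => [? ?] [? ?].
Qed.

Lemma re_trmx m n (A : 'M[R[i]]_(m, n)) : re_mx A^T = (re_mx A)^T.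
Proof. by apply/matrixP => i j; rewrite !mxE. Qed.

Lemma im_trmx m n (A : 'M[R[i]]_(m, n)) : im_mx A^T = (im_mx A)^T.
Proof. by apply/matrixP => i j; rewrite !mxE. Qed.

Definition star m n (A : 'M[R[i]]_(m, n)) : 'M[R[i]]_(n, m) := (map_mx (@conjc R) A)^T.

Lemma re_star m n (A : 'M[R[i]]_(m, n)) : re_mx (star A) = (re_mx A)^T.
Proof. by apply/matrixP => i j; rewrite !mxE; case: (A j i). Qed.

Lemma im_star m n (A : 'M[R[i]]_(m, n)) : im_mx (star A) = - (im_mx A)^T.
Proof. by apply/matrixP => i j; rewrite !mxE; case: (A j i). Qed.

Lemma star_mul m n p (A : 'M[R[i]]_(m, n)) (B : 'M[R[i]]_(n, p)) :
  star (A *m B) = star B *m star A.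
Proof. by rewrite /star map_mxM trmx_mul. Qed.

Lemma starK m n (A : 'M[R[i]]_(m, n)) : star (star A) = A.
Proof. by apply/matrixP => i j; rewrite !mxE conjcK. Qed.

Section Derivatives.
Variables (V : normedModType R) (U : set V).
Hypothesis Uo : open U.

Definition cplx_derive m n (v : V) (F : V -> 'M[R[i]]_(m, n)) (x : V) : 'M[R[i]]_(m, n) :=
  cplx_mx ('D_v (fun y => re_mx (F y)) x) ('D_v (fun y => im_mx (F y)) x).

(** Differentiation over R of complex matrices, through real and imaginary parts. *)
Definition is_cplx_derive m n (x v : V) (F : V -> 'M[R[i]]_(m, n)) dF :=
  is_derive x v (fun y => re_mx (F y)) (re_mx dF) /\
  is_derive x v (fun y => im_mx (F y)) (im_mx dF).

Definition smooth_cplx_mx m n (F : V -> 'M[R[i]]_(m, n)) :=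
  smooth_mx U (fun x => re_mx (F x)) /\ smooth_mx U (fun x => im_mx (F x)).

Lemma cplx_derive_val m n x v (F : V -> 'M[R[i]]_(m, n)) dF :
  is_cplx_derive x v F dF -> cplx_derive v F x = dF.
Proof. by move=> [[_ E1] [_ E2]]; rewrite /cplx_derive E1 E2 cplx_re_im. Qed.

Lemma smooth_is_cplx_derive m n x v (F : V -> 'M[R[i]]_(m, n)) :
  smooth_cplx_mx F -> U x -> is_cplx_derive x v F (cplx_derive v F x).
Proof.
move=> [Fr Fi] Ux; rewrite /is_cplx_derive /cplx_derive re_cplx im_cplx.
by split; [exact: smooth_mx_is_derive Fr Ux|exact: smooth_mx_is_derive Fi Ux].
Qed.

Lemma is_cplx_derive_congr m n x v (F G : V -> 'M[R[i]]_(m, n)) dF :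
  U x -> (forall y, U y -> F y = G y) ->
  is_cplx_derive x v F dF -> is_cplx_derive x v G dF.
Proof.
move=> Ux FG [Fr Fi]; split.
  by apply: near_eq_is_derive Fr; apply: (nearU Uo Ux) => y /FG ->.
by apply: near_eq_is_derive Fi; apply: (nearU Uo Ux) => y /FG ->.
Qed.

Lemma is_cplx_derive_mul m n p x v (F : V -> 'M[R[i]]_(m, n)) (G : V -> 'M[R[i]]_(n, p)) dF dG :
  is_cplx_derive x v F dF -> is_cplx_derive x v G dG ->
  is_cplx_derive x v (fun y => F y *m G y) (dF *m G x + F x *m dG).
Proof.
move=> [Fr Fi] [Gr Gi]; split.
  have -> : (fun y => re_mx (F y *m G y)) =
      (fun y => re_mx (F y) *m re_mx (G y)) - (fun y => im_mx (F y) *m im_mx (G y)).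
    by apply/funext => y; rewrite re_mulmx.
  have -> : re_mx (dF *m G x + F x *m dG) =
     (re_mx dF *m re_mx (G x) + re_mx (F x) *m re_mx dG)
     - (im_mx dF *m im_mx (G x) + im_mx (F x) *m im_mx dG).
    by rewrite /re_mx map_mxD -!/(re_mx _) !re_mulmx addrACA opprD.
  by apply: is_deriveB; exact: is_derive_mulmx.
have -> : (fun y => im_mx (F y *m G y)) =
    (fun y => re_mx (F y) *m im_mx (G y)) + (fun y => im_mx (F y) *m re_mx (G y)).
  by apply/funext => y; rewrite im_mulmx.
have -> : im_mx (dF *m G x + F x *m dG) =
   (re_mx dF *m im_mx (G x) + re_mx (F x) *m im_mx dG)
   + (im_mx dF *m re_mx (G x) + im_mx (F x) *m re_mx dG).
  by rewrite /im_mx map_mxD -!/(im_mx _) !im_mulmx addrACA.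
by apply: is_deriveD; exact: is_derive_mulmx.
Qed.

Lemma is_cplx_derive_star m n x v (F : V -> 'M[R[i]]_(m, n)) dF :
  is_cplx_derive x v F dF -> is_cplx_derive x v (fun y => star (F y)) (star dF).
Proof.
move=> [Fr Fi]; split.
  rewrite re_star (_ : (fun y => _) = fun y => (re_mx (F y))^T); last first.
    by apply/funext => y; rewrite re_star.
  exact: is_derive_trmx.
rewrite im_star (_ : (fun y => _) = - (fun y => (im_mx (F y))^T)); last first.
  by apply/funext => y; rewrite im_star.
exact/is_deriveN/is_derive_trmx.
Qed.

Lemma is_cplx_derive_trmx m n x v (F : V -> 'M[R[i]]_(m, n)) dF :
  is_cplx_derive x v F dF -> is_cplx_derive x v (fun y => (F y)^T) dF^T.
Proof.
move=> [Fr Fi]; split.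
  rewrite re_trmx (_ : (fun y => _) = fun y => (re_mx (F y))^T); last first.
    by apply/funext => y; rewrite re_trmx.
  exact: is_derive_trmx.
rewrite im_trmx (_ : (fun y => _) = fun y => (im_mx (F y))^T); last first.
  by apply/funext => y; rewrite im_trmx.
exact: is_derive_trmx.
Qed.

Lemma is_cplx_derive_cst m n x v (A : 'M[R[i]]_(m, n)) :
  is_cplx_derive x v (fun=> A) 0.
Proof.
have -> : (0 : 'M[R[i]]_(m, n)) = cplx_mx 0 0 by apply/matrixP => i j; rewrite !mxE.
by rewrite /is_cplx_derive re_cplx im_cplx; split; exact: is_derive_cst.
Qed.

Lemma smooth_cplx_mxM m n p (F : V -> 'M[R[i]]_(m, n)) (G : V -> 'M[R[i]]_(n, p)) :
  smooth_cplx_mx F -> smooth_cplx_mx G -> smooth_cplx_mx (fun y => F y *m G y).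
Proof.
move=> [Fr Fi] [Gr Gi]; split.
  apply: (smooth_mx_congr Uo (fun y _ => esym (re_mulmx _ _))).
  by apply: smooth_mxD => //; [|apply: smooth_mxN => //]; apply: smooth_mxM.
apply: (smooth_mx_congr Uo (fun y _ => esym (im_mulmx _ _))).
by apply: smooth_mxD => //; apply: smooth_mxM.
Qed.

Lemma smooth_cplx_star m n (F : V -> 'M[R[i]]_(m, n)) :
  smooth_cplx_mx F -> smooth_cplx_mx (fun y => star (F y)).
Proof.
move=> [Fr Fi]; split.
  by apply: (smooth_mx_congr Uo (fun y _ => esym (re_star _))); exact: smooth_mxT.
apply: (smooth_mx_congr Uo (fun y _ => esym (im_star _))).
by apply: smooth_mxN => //; exact: smooth_mxT.
Qed.

Lemma smooth_cplx_derive m n (F : V -> 'M[R[i]]_(m, n)) v :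
  smooth_cplx_mx F -> smooth_cplx_mx (cplx_derive v F).
Proof.
move=> [Fr Fi]; split.
  by apply: (smooth_mx_congr Uo (fun y _ => esym (re_cplx _ _))); exact: smooth_mx_derive.
by apply: (smooth_mx_congr Uo (fun y _ => esym (im_cplx _ _))); exact: smooth_mx_derive.
Qed.

Lemma cplx_derive_comm m n (F : V -> 'M[R[i]]_(m, n)) x u v :
  smooth_cplx_mx F -> U x ->
  cplx_derive u (cplx_derive v F) x = cplx_derive v (cplx_derive u F) x.
Proof.
move=> [Fr Fi] Ux.
have rE w : (fun y => re_mx (cplx_derive w F y)) = 'D_w (fun y => re_mx (F y)).
  by apply/funext => y; rewrite re_cplx.
have iE w : (fun y => im_mx (cplx_derive w F y)) = 'D_w (fun y => im_mx (F y)).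
  by apply/funext => y; rewrite im_cplx.
have E w w' : cplx_derive w (cplx_derive w' F) x =
    cplx_mx ('D_w ('D_w' (fun y => re_mx (F y))) x) ('D_w ('D_w' (fun y => im_mx (F y))) x).
  by rewrite -rE -iE.
have C := congr2 (@cplx_mx R m n) (smooth_mx_derive_comm Uo u v Fr Ux)
  (smooth_mx_derive_comm Uo u v Fi Ux).
exact (etrans (E u v) (etrans C (esym (E v u)))).
Qed.

Section RealLinear.
Variables (m n p q : nat) (f : 'M[R[i]]_(m, n) -> 'M[R]_(p, q)).
Hypothesis fD : forall A B, f (A + B) = f A + f B.
Hypothesis fZ : forall (r : R) A, f (r%:C *: A) = r *: f A.

Let fre (B : 'M[R]_(m, n)) := f (cplx_mx B 0).
Let fim (B : 'M[R]_(m, n)) := f (cplx_mx 0 B).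

Let fre_linear : linear fre.
Proof.
move=> r A B; rewrite /fre -fZ -fD; congr f; apply/matrixP => i j; rewrite !mxE.
by apply/eqP; rewrite eq_complex /=; apply/andP; split; apply/eqP; ring.
Qed.

Let fim_linear : linear fim.
Proof.
move=> r A B; rewrite /fim -fZ -fD; congr f; apply/matrixP => i j; rewrite !mxE.
by apply/eqP; rewrite eq_complex /=; apply/andP; split; apply/eqP; ring.
Qed.

Let fE A : f A = fre (re_mx A) + fim (im_mx A).
Proof.
rewrite /fre /fim -fD; congr f; apply/matrixP => i j; rewrite !mxE.
by case: (A i j) => a b; apply/eqP; rewrite eq_complex /= addr0 add0r !eqxx.
Qed.

Lemma is_derive_real_linear x v (F : V -> 'M[R[i]]_(m, n)) dF :
  is_cplx_derive x v F dF -> is_derive x v (fun y => f (F y)) (f dF).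
Proof.
move=> [Fr Fi]; rewrite fE.
have -> : (fun y => f (F y)) =
    (fun y => fre (re_mx (F y))) + (fun y => fim (im_mx (F y))).
  by apply/funext => y; rewrite fE.
by apply: is_deriveD; exact: is_derive_linear.
Qed.

Lemma smooth_real_linear (F : V -> 'M[R[i]]_(m, n)) :
  smooth_cplx_mx F -> smooth_mx U (fun y => f (F y)).
Proof.
have lin (g : 'M[R]_(m, n) -> 'M[R]_(p, q)) (G : V -> 'M[R]_(m, n)) :
    linear g -> smooth_mx U G -> smooth_mx U (fun y => g (G y)).
  move=> gl Gs i j.
  apply: (@smooth_congr _ _ _ _
    (fun y => \sum_k \sum_l G y k l * g (delta_mx k l) i j : R^o)) => //.
    move=> y _; rewrite (linear_mx_sum (G y) gl) summxE; apply: eq_bigr => k _.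
    by rewrite summxE; apply: eq_bigr => l _; rewrite mxE.
  apply: smooth_sum => // k; apply: smooth_sum => // l.
  by apply: smoothM => //; exact: smooth_cst.
move=> [Fr Fi]; apply: (smooth_mx_congr Uo (fun y _ => esym (fE (F y)))).
by apply: smooth_mxD => //; exact: lin.
Qed.

End RealLinear.
End Derivatives.

End ComplexMatrices.

(** * The Maurer-Cartan coframe of a chart *)

#[local] Opaque symplJ.

Section ChartCoframe.
Local Open Scope complex_scope.
Variables (R : realType) (U : set 'rV[R]_7) (sigma : 'rV[R]_7 -> 'M[R[i]]_4).
Hypothesis sigma_chart : chart U sigma.
Local Notation V := 'rV[R]_7.
Local Notation C4 := 'M[R[i]]_4.
Local Notation hh := (@lie_h R).

Let Uo : open U. Proof. by case: sigma_chart => [[]]. Qed.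

Let sigma_Sp2 x : U x -> Sp2 (sigma x).
Proof. by case: sigma_chart => [[_]] + _ _ _ _; exact. Qed.

Lemma chart_smooth : smooth_cplx_mx U sigma.
Proof.
case: sigma_chart => _ sr si _ _.
by split=> i j; [exact: smooth_entry sr|exact: smooth_entry si].
Qed.

Definition maurer_cartan (v x : V) : C4 := star (sigma x) *m cplx_derive v sigma x.

Lemma star_sigma x : U x -> star (sigma x) *m sigma x = 1%:M.
Proof. by move=> /sigma_Sp2[]. Qed.

Lemma sigma_star x : U x -> sigma x *m star (sigma x) = 1%:M.
Proof. by move=> /star_sigma; exact: mulmx1C. Qed.

Lemma invmx_sigma x : U x -> invmx (sigma x) = star (sigma x).
Proof.
move=> Ux; have [su _] := mulmx1_unit (sigma_star Ux).
by rewrite -[LHS]mul1mx -(star_sigma Ux) mulmxK.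
Qed.

Lemma smooth_maurer_cartan v : smooth_cplx_mx U (maurer_cartan v).
Proof.
apply: smooth_cplx_mxM => //; first exact: smooth_cplx_star chart_smooth.
exact: smooth_cplx_derive chart_smooth.
Qed.

Lemma sigma_maurer_cartan v x : U x ->
  sigma x *m maurer_cartan v x = cplx_derive v sigma x.
Proof. by move=> Ux; rewrite /maurer_cartan mulmxA sigma_star // mul1mx. Qed.

(** Differentiate the two equations defining [Sp2]. *)
Lemma sp_maurer_cartan v x : U x -> sp (maurer_cartan v x).
Proof.
move=> Ux; have sd := smooth_is_cplx_derive v chart_smooth Ux.
split.
  rewrite -/(star (maurer_cartan v x)) /maurer_cartan star_mul starK.
  have d1 := is_cplx_derive_mul (is_cplx_derive_star sd) sd.
  have d2 := is_cplx_derive_congr Uo Ux star_sigma d1.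
  by rewrite -(cplx_derive_val d2) (cplx_derive_val (is_cplx_derive_cst _ _ _)).
have sJ y : U y -> (sigma y)^T *m symplJ R *m sigma y = symplJ R.
  by move=> /sigma_Sp2[].
have dJ := is_cplx_derive_mul (is_cplx_derive_mul (is_cplx_derive_trmx sd)
  (is_cplx_derive_cst x v (symplJ R))) sd.
have := cplx_derive_val (is_cplx_derive_congr Uo Ux sJ dJ).
rewrite (cplx_derive_val (is_cplx_derive_cst _ _ _)) mulmx0 addr0.
rewrite -(sigma_maurer_cartan v Ux) trmx_mul => E.
have e1 : (maurer_cartan v x)^T *m symplJ R =
    (maurer_cartan v x)^T *m (sigma x)^T *m symplJ R *m sigma x.
  by rewrite -!mulmxA; congr (_ *m _); rewrite mulmxA sJ.
have e2 : symplJ R *m maurer_cartan v x =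
    (sigma x)^T *m symplJ R *m (sigma x *m maurer_cartan v x).
  by rewrite mulmxA sJ.
exact: etrans (congr2 +%R e1 e2) (esym E).
Qed.

(** From d(sigma^-1) = - alpha sigma^-1 and the symmetry of second derivatives. *)
Lemma maurer_cartan_eq u v x : U x ->
  cplx_derive u (maurer_cartan v) x - cplx_derive v (maurer_cartan u) x =
  - bracket (maurer_cartan u x) (maurer_cartan v x).
Proof.
move=> Ux.
have dmc w w' : cplx_derive w (maurer_cartan w') x =
    - (maurer_cartan w x *m maurer_cartan w' x)
    + star (sigma x) *m cplx_derive w (cplx_derive w' sigma) x.
  have sd := smooth_is_cplx_derive w chart_smooth Ux.
  have dd := smooth_is_cplx_derive w (smooth_cplx_derive Uo w' chart_smooth) Ux.
  rewrite (cplx_derive_val (is_cplx_derive_mul (is_cplx_derive_star sd) dd)).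
  congr (_ + _); rewrite -(sigma_maurer_cartan w Ux) star_mul -mulmxA.
  rewrite -/(maurer_cartan w' x) -mulNmx; congr (_ *m _).
  have [/eqP + _] := sp_maurer_cartan w Ux.
  by rewrite -/(star _) addr_eq0 => /eqP.
have comm := cplx_derive_comm Uo u v chart_smooth Ux.
have cancel (A B C : C4) : - (A *m B) + C - (- (B *m A) + C) = - (A *m B - B *m A).
  by rewrite opprD opprK addrACA subrr addr0 opprB addrC.
rewrite (dmc u v) (dmc v u) comm; exact: cancel.
Qed.

Lemma cplx_derive_linear m n (F : V -> 'M[R[i]]_(m, n)) x r u v :
  smooth_cplx_mx U F -> U x ->
  cplx_derive (r *: u + v) F x = r%:C *: cplx_derive u F x + cplx_derive v F x.
Proof.
move=> [Fr Fi] Ux.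
have lin (G : V -> 'M[R]_(m, n)) : smooth_mx U G ->
    'D_(r *: u + v) G x = r *: 'D_u G x + 'D_v G x.
  move=> Gs; have Gd := smooth_mx_differentiable Gs Ux.
  by rewrite !deriveE // linearP.
have lin2 (A A' B B' : 'M[R]_(m, n)) :
    cplx_mx (r *: A + A') (r *: B + B') = r%:C *: cplx_mx A B + cplx_mx A' B'.
  apply/matrixP => i j; rewrite !mxE; apply/eqP; rewrite eq_complex /=.
  by apply/andP; split; apply/eqP; ring.
exact (etrans (congr2 (@cplx_mx R m n) (lin _ Fr) (lin _ Fi)) (lin2 _ _ _ _)).
Qed.

Lemma maurer_cartan_linear x r u v : U x ->
  maurer_cartan (r *: u + v) x = r%:C *: maurer_cartan u x + maurer_cartan v x.
Proof.
move=> Ux; rewrite /maurer_cartan (cplx_derive_linear _ _ _ chart_smooth Ux).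
by rewrite mulmxDr scalemxAr.
Qed.

(** Its i-th row is the value of theta on the i-th coordinate vector. *)
Definition coframe (x : V) : 'M[R]_7 :=
  \matrix_(i, j) mcoord (maurer_cartan (delta_mx 0 i) x) 0 j.

Lemma coframeE v x : U x -> v *m coframe x = mcoord (maurer_cartan v x).
Proof.
move=> Ux; have col : linear (fun v => mcoord (maurer_cartan v x)).
  by move=> r a b; rewrite maurer_cartan_linear // mcoordD mcoordZ.
rewrite (linear_mx_sum v col) big_ord1; apply/rowP => j.
rewrite mxE summxE; apply: eq_bigr => i _; rewrite !mxE; reflexivity.
Qed.

Lemma smooth_coframe : smooth_mx U coframe.
Proof.
move=> i j.
have cs := smooth_real_linear Uo (@mcoordD R) (@mcoordZ R) (smooth_maurer_cartan (delta_mx 0 i))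
    0 j.
by apply: (smooth_congr Uo _ cs) => y _; rewrite [RHS]mxE.
Qed.

Lemma derive_coframe u v x : U x ->
  v *m 'D_u coframe x = mcoord (cplx_derive u (maurer_cartan v) x).
Proof.
move=> Ux; have [_ <-] := is_derive_real_linear (@mcoordD R) (@mcoordZ R)
  (smooth_is_cplx_derive u (smooth_maurer_cartan v) Ux).
have [_ <-] := is_derive_mulmxl v (smooth_mx_is_derive u smooth_coframe Ux).
by apply: near_eq_derive; apply: (nearU Uo Ux) => y Uy; exact: coframeE.
Qed.

Lemma tangent_mvec x v : U x -> tangent_m sigma x v = mvec (v *m coframe x).
Proof. by move=> Ux; rewrite /tangent_m invmx_sigma // proj_mE coframeE. Qed.

Lemma ip_mvec (a b : V) : ip (mvec a) (mvec b) = dot a b.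
Proof.
rewrite -{2}(mvecK b) /dot mxE /mvec ip_suml; apply: eq_bigr => k _.
by rewrite ipZl !mxE ipC.
Qed.

Lemma metric_coframe x u v : U x ->
  metric sigma x u v = dot (u *m coframe x) (v *m coframe x).
Proof. by move=> Ux; rewrite /metric !tangent_mvec // ip_mvec. Qed.

(** A chart is immersive into V_1. *)
Lemma coframe_unit x : U x -> coframe x \in unitmx.
Proof.
move=> Ux; rewrite -row_free_unit -kermx_eq0; apply/rowV0P => v /sub_kermxP v0.
case: sigma_chart => _ _ _ _ /(_ _ v Ux); apply; rewrite tangent_mvec // v0.
by rewrite /mvec big1 // => k _; rewrite mxE scale0r.
Qed.

Lemma conn_torsion_free x u v : U x ->
  v *m 'D_u coframe x + v *m coframe x *m conn (maurer_cartan u x) =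
  u *m 'D_v coframe x + u *m coframe x *m conn (maurer_cartan v x).
Proof.
move=> Ux; rewrite (derive_coframe u v Ux) (derive_coframe v u Ux).
rewrite (coframeE u Ux) (coframeE v Ux).
have coB (A B : C4) : mcoord (A - B) = mcoord A - mcoord B by rewrite mcoordD mcoordN.
have swap (p q s t : V) : p - q = - (s - t) -> p + s = q + t.
  by move=> e; apply/eqP; rewrite -subr_eq0 opprD addrACA e addNr.
apply swap; rewrite (conn_torsion (sp_maurer_cartan u Ux) (sp_maurer_cartan v Ux)).
have eq := congr1 (@mcoord R) (maurer_cartan_eq u v Ux).
exact (etrans (esym (coB _ _)) (etrans eq (mcoordN _))).
Qed.

Lemma christoffel_chart x u v : U x ->
  christoffel (metric sigma) x u v *m coframe x =
  v *m 'D_u coframe x + v *m coframe x *m conn (maurer_cartan u x).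
Proof.
exact: (christoffel_coframe Uo smooth_coframe coframe_unit metric_coframe
  (Lambda := fun x u => conn (maurer_cartan u x)) (fun _ _ _ => conn_skew _) conn_torsion_free).
Qed.

Lemma curvature_chart x u v w : U x ->
  curvature (metric sigma) x u v w *m coframe x =
  w *m coframe x *m curv (u *m coframe x) (v *m coframe x).
Proof.
move=> Ux.
have conn_smooth p : smooth_mx U (fun y => conn (maurer_cartan p y)).
  exact: (smooth_real_linear Uo (@connD R) (@connZ R) (smooth_maurer_cartan p)).
have dLam p q : 'D_p (fun y => conn (maurer_cartan q y)) x =
    conn (cplx_derive p (maurer_cartan q) x).
  have [_ E] := is_derive_real_linear (@connD R) (@connZ R)
    (smooth_is_cplx_derive p (smooth_maurer_cartan q) Ux).
  exact: E.
have dd : 'D_u (fun y => conn (maurer_cartan v y)) x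
      - 'D_v (fun y => conn (maurer_cartan u y)) x
    = - conn (bracket (maurer_cartan u x) (maurer_cartan v x)).
  have LamB (A B : C4) : conn (A - B) = conn A - conn B by rewrite connD connN.
  have e := etrans (congr1 (@conn R) (maurer_cartan_eq u v Ux)) (connN _).
  exact (etrans (congr2 (fun a b => a - b) (dLam u v) (dLam v u))
                (etrans (esym (LamB _ _)) e)).
have curv := curvature_coframe Uo smooth_coframe coframe_unit metric_coframe
  (Lambda := fun x u => conn (maurer_cartan u x)) conn_smooth
  (fun _ _ _ => conn_skew _) conn_torsion_free u v w Ux.
rewrite (coframeE u Ux) (coframeE v Ux).
apply: etrans curv _; congr (_ *m _).
exact (etrans (congr1 (fun z => z + _ - _) dd)
  (conn_curvature (sp_maurer_cartan u Ux) (sp_maurer_cartan v Ux))).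
Qed.

End ChartCoframe.

(** * The theorem *)

Theorem lemma3p1 (R : realType) (a b : R) (gamma : R -> set 'M[R[i]]_4)
    (ha : a < 0) (hb : 0 < b)
    (hgeo : geodesic `]a, b[ gamma) (hunit : unit_speed `]a, b[ gamma)
    (h0 : gamma 0 = @origin R)
    (U : set 'rV[R]_7) (sigma : 'rV[R]_7 -> 'M[R[i]]_4) (c : R -> 'rV[R]_7)
    (hU : chart U sigma) (hc : coord_expr U sigma gamma 0 c) :
  let Rt (k : nat) (v : 'rV[R]_7) := jacobi_deriv (metric sigma) c k 0 v in
  let s := speed (metric sigma) c 0 in
  (forall v : 'rV[R]_7,
     Rt 3%N v = - (s ^+ 2 *: Rt 1%N v) /\ - (s ^+ 2 *: Rt 1%N v) = - Rt 1%N v)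
  /\
  (forall v : 'rV[R]_7,
     Rt 4%N v = - (s ^+ 2 *: Rt 2%N v) /\ - (s ^+ 2 *: Rt 2%N v) = - Rt 2%N v).
Proof.
move=> Rt s.
have I0 : `]a, b[%classic (0 : R) by rewrite /= in_itv /= ha hb.
have s1 : s = 1 := hunit _ _ _ _ I0 hU hc.
have [W [Wo W0 cs cW]] := hc.
(* The geodesic equation is available on the whole interval only where the curve
   stays in the chart. *)
pose W' : set R^o := W `&` `]a, b[%classic.
have W'o : open W' by apply: openI => //; exact: interval_open.
have W'0 : W' 0 by [].
have cU t : W' t -> U (c t) by move=> [/cW[]].
have c1 (t : R) : W' t -> is_derive (t : R^o) 1 (c : R^o -> 'rV[R]_7) (derive1 c t).
  by move=> [Wt _]; rewrite derive1E; exact: smooth_is_derive cs Wt.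
have c2 (t : R) : W' t ->
    is_derive (t : R^o) 1 (derive1 c : R^o -> 'rV[R]_7) (derive1n 2 c t).
  move=> [Wt _]; rewrite derive1nS derive1n1 derive1E.
  have -> : derive1 c = 'D_1 (c : R^o -> 'rV[R]_7) by apply/funext => u; rewrite derive1E.
  exact (smooth_is_derive (1 : R^o) (smooth_derive (1 : R^o) cs) Wt).
have cgeo t : W' t -> acceleration (metric sigma) c t = 0.
  by move=> [Wt It]; apply: hgeo.2 It hU _; exists W.
have [[Uo _] _ _ _ _] := hU.
pose X := derive1 c 0 *m coframe sigma (c 0).
have U0 := cU 0 W'0.
have XX : dot X X = 1.
  rewrite -(metric_coframe hU _ _ U0); move: s1; rewrite /s /speed.
  set q := metric _ _ _ _ => q1; have : 0 <= q.
    by rewrite leNgt; apply/negP => /ltW /ler0_sqrtr q0; move: q1; rewrite q0 => /eqP;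
       rewrite eq_sym oner_eq0.
  by move/sqr_sqrtr => <-; rewrite q1 expr1n.
pose iso : set 'M[R]_7 := [set ad_m Z | Z in lie_h (R := R)].
have curv_inv A x y : iso A ->
    curv x y *m A = A *m curv x y + curv (x *m A) y + curv x (y *m A).
  by move=> [Z hZ <-]; exact: curv_invariant.
have half_ad_inv A x : iso A -> half_ad x *m A = A *m half_ad x + half_ad (x *m A).
  by move=> [Z hZ <-]; exact: half_ad_invariant.
pose H x u := ad_m (maurer_cartan sigma u x - mvec (mcoord (maurer_cartan sigma u x))).
have H_iso x u : U x -> iso (H x u).
  by move=> Ux; eexists; [exact: sp_split (sp_maurer_cartan hU u Ux)|].
have chE x u v : U x -> christoffel (metric sigma) x u v *m coframe sigma x =
    v *m 'D_u (coframe sigma) x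
    + v *m coframe sigma x *m (H x u + half_ad (u *m coframe sigma x)).
  move=> Ux; rewrite (coframeE hU u Ux); exact (christoffel_chart hU u v Ux).
have JE k v : Rt k v *m coframe sigma (c 0) =
    jet (@curv R) (@half_ad R) k X (v *m coframe sigma (c 0)) X X.
  exact: (jacobi_deriv_jet (@curv_linl R) (@curv_linr R) curv_inv (@half_ad_linear R) half_ad_inv
    (@half_ad_alt R) Uo (smooth_coframe hU) (coframe_unit hU) H_iso chE (curvature_chart hU)
    W'o cU c1 c2 cgeo k v W'0).
(* The coframe at the base point is invertible, so components determine vectors. *)
have inj := can_inj (mulmxK (coframe_unit hU U0)).
have s2 : s ^+ 2 = 1 by rewrite s1 expr1n.
split=> v; rewrite s2 scale1r; split=> //; apply: inj; rewrite mulNmx !JE.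
  have := jet3_diagonal (@curv_linl R) (@curv_linr R) (@curv_skew R) (@curv_alt R)
    (@half_ad_alt R) (@half_ad_cross R) X (v *m coframe sigma (c 0)).
  by rewrite XX scale1r.
have := jet4_diagonal (@curv_linl R) (@curv_linr R) (@curv_skew R) (@curv_alt R)
  (@half_ad_alt R) (@half_ad_cross R) X (v *m coframe sigma (c 0)).
by rewrite XX scale1r.
Qed.
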